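(* Let $R$ be any countable commutative ring (not necessarily unital), let $G=\mathrm{UT}_n(R)$ for some $n\in\mathbb{N}$, and let $A\subseteq G$. Then for any left Følner sequence $F=(F_N)_{N\in\mathbb{N}}$ in $G$ there exists $B\subseteq G$ such that $\overline{d}_F(B)\geq d^*_l(A)^{2^{n-1}}$ and $BB\subseteq AA^{-1}$.
   Context: ''Countable'' means in bijective correspondence with $\mathbb{N}$. For a commutative ring $R$ (if $R$ has no multiplicative identity, view it as a subring of a unital ring with identity $1$), $\mathrm{UT}_n(R)$ denotes the group, under matrix multiplication, of $n\times n$ upper triangular matrices with all diagonal entries equal to $1$ and all entries above the diagonal in $R$. A left Følner sequence in a group $G$ is a sequence $(F_N)_{N\in\mathbb{N}}$ of finite nonempty subsets of $G$ such that $\lim_{N\to\infty}\frac{|gF_N\Delta F_N|}{|F_N|}=0$ for all $g\in G$. For $E\subseteq G$, $\overline{d}_F(E)=\limsup_{N\to\infty}\frac{|E\cap F_N|}{|F_N|}$, and the left upper Banach density is $d^*_l(E)=\sup\{\overline{d}_F(E):F\text{ a left Følner sequence in }G\}$. $BB=\{bb':b,b'\in B\}$ and $AA^{-1}=\{aa'^{-1}:a,a'\in A\}$. *)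

(* Defs.v *)
From HB Require Import structures.
From mathcomp Require Import all_boot all_order all_algebra.
From mathcomp Require Import finmap.
From mathcomp Require Import all_classical all_reals all_analysis.
Set Implicit Arguments.
Unset Strict Implicit.
Unset Printing Implicit Defensive.
Import Order.TTheory GRing.Theory Num.Theory.
Import numFieldNormedType.Exports.

Local Open Scope classical_set_scope.
Local Open Scope ring_scope.

(* A possibly non-unital ring is presented as a subset of a unital ring [S]
   containing 0 and closed under differences and products; [1 \in R] is not
   required. *)
Record nonUnitalSubring (S : pzRingType) := NonUnitalSubring {
  nus_pred :> {pred S} ;
  nus_zmod_closed : zmod_closed nus_pred ;
  nus_mul_closed : GRing.mulr_2closed nus_pred }.

HB.instance Definition _ (S : pzRingType) (R : nonUnitalSubring S) :=
  GRing.isZmodClosed.Build S (nus_pred R) (@nus_zmod_closed S R).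
HB.instance Definition _ (S : pzRingType) (R : nonUnitalSubring S) :=
  GRing.isMul2Closed.Build S (nus_pred R) (@nus_mul_closed S R).

Section Unitriangular.
Context (S : pzRingType) (R : nonUnitalSubring S) (n : nat).

Definition unitriangular (M : 'M[S]_n) : bool :=
  [forall i : 'I_n, forall j : 'I_n,
     [&& (i == j) ==> (M i j == 1),
         (i < j)%N ==> (M i j \in R)
       & (j < i)%N ==> (M i j == 0)]].

Record UT := MkUT { UT_mx :> 'M[S]_n ; _ : unitriangular UT_mx }.

HB.instance Definition _ := [isSub for UT_mx].
HB.instance Definition _ := [Choice of UT by <:].

Lemma unitriangularP (M : 'M[S]_n) :
  reflect [/\ forall i, M i i = 1,
              forall i j : 'I_n, (i < j)%N -> M i j \in R
            & forall i j : 'I_n, (j < i)%N -> M i j = 0]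
          (unitriangular M).
Proof.
apply: (iffP forallP) => [H|[H1 H2 H3] i].
  split=> [i|i j ij|i j ij]; move/forallP: (H i).
  - by move=> /(_ i); rewrite eqxx => /and3P[/eqP].
  - by move=> /(_ j); rewrite ij => /and3P[].
  - by move=> /(_ j); rewrite ij => /and3P[_ _ /eqP].
apply/forallP => j; apply/and3P; split; apply/implyP.
- by move=> /eqP <-; rewrite H1.
- exact: H2.
- by move=> /H3 ->.
Qed.

Lemma unitriangular1 : unitriangular 1.
Proof.
apply/unitriangularP; split=> [i|i j ij|i j ij]; rewrite mxE ?eqxx//.
- by rewrite -val_eqE ltn_eqF// rpred0.
- by rewrite -val_eqE gtn_eqF.
Qed.

Lemma unitriangularM (M N : 'M[S]_n) :
  unitriangular M -> unitriangular N -> unitriangular (M * N).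
Proof.
move=> /unitriangularP[M1 MR M0] /unitriangularP[N1 NR N0].
apply/unitriangularP; split=> [i|i j ij|i j ij]; rewrite mxE.
- rewrite (bigD1 i)//= M1 N1 mulr1 big1 ?addr0// => k.
  rewrite -val_eqE neq_ltn => /orP[ki|ik]; first by rewrite M0// mul0r.
  by rewrite N0// mulr0.
- apply: rpred_sum => k _.
  have [ik|ki|/val_inj ik] := ltngtP i k.
  + have [kj|jk|/val_inj kj] := ltngtP k j.
    * by rewrite rpredM ?MR ?NR.
    * by rewrite N0// mulr0 rpred0.
    * by rewrite kj N1 mulr1 MR.
  + by rewrite M0// mul0r rpred0.
  + by rewrite -ik M1 mul1r NR.
- rewrite big1// => k _.
  have [ki|ik] := ltnP k i; first by rewrite M0// mul0r.
  by rewrite N0 ?mulr0// (leq_trans ij).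
Qed.

(* Geometric series: [1 - M] is strictly upper triangular, hence nilpotent. *)
Definition unitriangular_inv (M : 'M[S]_n) : 'M[S]_n :=
  \sum_(k < n) (1 - M) ^+ k.

Lemma sub1_unitriangularX (M : 'M[S]_n) k : unitriangular M ->
  forall i j : 'I_n, (j < i + k)%N -> ((1 - M) ^+ k) i j = 0.
Proof.
move=> /unitriangularP[M1 MR M0]; elim: k => [|k IH] i j.
  by rewrite addn0 expr0 mxE -val_eqE => ji; rewrite gtn_eqF.
move=> ji; rewrite exprS mxE big1// => l _.
have [li|il] := leqP l i; last first.
  by rewrite IH ?mulr0// (leq_trans ji)// addnS -addSn leq_add2r.
rewrite !mxE; have [/eqP ->|il] := boolP (i == l).
  by rewrite M1 subrr mul0r.
by rewrite M0 ?subrr ?mul0r// ltn_neqAle li andbT eq_sym.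
Qed.

Lemma sub1_unitriangularR (M : 'M[S]_n) k : unitriangular M ->
  forall i j : 'I_n, ((1 - M) ^+ k.+1) i j \in R.
Proof.
move=> uM; have /unitriangularP[M1 MR M0] := uM.
have H i j : (1 - M) i j \in R.
  have [ij|ij] := ltnP i j.
    by rewrite !mxE -val_eqE ltn_eqF// rpredB ?rpred0 ?MR.
  have [e|ne] := eqVneq i j; first by rewrite !mxE e eqxx M1 subrr rpred0.
  rewrite !mxE (negbTE ne) M0 ?subrr ?rpred0//.
  by rewrite ltn_neqAle ij andbT eq_sym.
elim: k => [|k IH] i j; first by rewrite expr1.
by rewrite exprS mxE; apply: rpred_sum => l _; rewrite rpredM ?IH.
Qed.

Lemma unitriangularV (M : 'M[S]_n) :
  unitriangular M -> unitriangular (unitriangular_inv M).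
Proof.
move=> uM; apply/unitriangularP; rewrite /unitriangular_inv.
split=> [i|i j ij|i j ij]; rewrite summxE.
- have n0 : (0 < n)%N by rewrite (leq_ltn_trans _ (ltn_ord i)).
  rewrite (bigD1 (Ordinal n0))//= expr0 mxE eqxx big1 ?addr0// => k k0.
  by rewrite (sub1_unitriangularX uM)// -[X in (X < _)%N]addn0 ltn_add2l lt0n.
- apply: rpred_sum => -[[|k] /= _] _; last exact: sub1_unitriangularR.
  by rewrite expr0 mxE -val_eqE ltn_eqF// rpred0.
- by rewrite big1// => k _; rewrite (sub1_unitriangularX uM)// ltn_addr.
Qed.

Lemma sub1_unitriangular_nil (M : 'M[S]_n) :
  unitriangular M -> (1 - M) ^+ n = 0.
Proof.
move=> uM; apply/matrixP => i j; rewrite (sub1_unitriangularX uM) ?mxE//.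
exact: ltn_addl.
Qed.

Lemma mulV_unitriangular (M : 'M[S]_n) :
  unitriangular M -> unitriangular_inv M * M = 1.
Proof.
move=> uM; have e : M = 1 - (1 - M) by rewrite subKr.
have comm : GRing.comm (unitriangular_inv M) M.
  rewrite {2}e; apply: commrB; first exact: commr1.
  by apply/commr_sym/commr_sum => k _; apply: commrX.
rewrite comm {1}e -[1 - _]opprB mulNr -subrX1 sub1_unitriangular_nil//.
by rewrite sub0r opprK.
Qed.

Lemma mulmV_unitriangular (M : 'M[S]_n) :
  unitriangular M -> M * unitriangular_inv M = 1.
Proof.
move=> uM; have e : M = 1 - (1 - M) by rewrite subKr.
rewrite {1}e -[1 - (1 - M)]opprB mulNr -subrX1 sub1_unitriangular_nil//.
by rewrite sub0r opprK.
Qed.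

Definition UT_mul (x y : UT) : UT :=
  MkUT (unitriangularM (valP x) (valP y)).
Definition UT_one : UT := MkUT unitriangular1.
Definition UT_inv (x : UT) : UT := MkUT (unitriangularV (valP x)).

Lemma UT_mulA : associative UT_mul.
Proof. by move=> x y z; apply: val_inj; exact: mulrA. Qed.
Lemma UT_mul1 : left_id UT_one UT_mul.
Proof. by move=> x; apply: val_inj; exact: mul1r. Qed.
Lemma UT_mulr1 : right_id UT_one UT_mul.
Proof. by move=> x; apply: val_inj; exact: mulr1. Qed.
Lemma UT_mulV : left_inverse UT_one UT_inv UT_mul.
Proof. by move=> x; apply: val_inj; exact: mulV_unitriangular (valP x). Qed.
Lemma UT_mulrV : right_inverse UT_one UT_inv UT_mul.
Proof. by move=> x; apply: val_inj; exact: mulmV_unitriangular (valP x). Qed.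

HB.instance Definition _ :=
  isGroup.Build UT UT_mulA UT_mul1 UT_mulr1 UT_mulV UT_mulrV.

Lemma UT_mulE (x y : UT) : (x * y)%g = UT_mx x *m UT_mx y :> 'M[S]_n.
Proof. by []. Qed.

End Unitriangular.

Section Density.
Context (K : realType) (G : groupType).
Implicit Types (F : nat -> {fset G}) (E A B : set G).

Definition left_translate (g : G) (X : {fset G}) : {fset G} :=
  [fset (g * x)%g | x in X]%fset.

Definition fsymdiff (X Y : {fset G}) : {fset G} :=
  ((X `\` Y) `|` (Y `\` X))%fset.

Definition left_Folner F : Prop :=
  (forall N, F N != fset0) /\
  forall g : G,
    (fun N => #|` fsymdiff (left_translate g (F N)) (F N)|%:R / #|` F N|%:R : K)
      @ \oo --> (0 : K).

Definition relative_density F E (N : nat) : K :=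
  #|` [fset x in F N | x \in E]%fset|%:R / #|` F N|%:R.

(* [relative_density F E] takes values in [0, 1], so [limn_sup] is a genuine
   limit superior, and the [sup] below is a genuine supremum as soon as [G] has
   a left Folner sequence. *)
Definition upper_density F E : K := limn_sup (relative_density F E).

Definition left_upper_Banach_density A : K :=
  sup [set upper_density F A | F in left_Folner].

Definition product_set A B : set G := [set (a * b)%g | a in A & b in B].

Definition inverse_set A : set G := [set (a^-1)%g | a in A].

End Density.

(* Main.v *)
(* Write [1_A] for the indicator of [A] and fix a left-invariant mean [m] on
   [G = UT R n] with [m 1_A >= d], [d] the Banach density of [A].  For [t] in
   [G] the set [B_t = {x | x t \in A and x^-1 t \in A}] satisfies
   [B_t B_t <= A A^-1], and the [m]-average over [t] of its density along [F]
   is the average of [phi (x ^ 2)], where [phi g = m (A \cap g^-1 A)].  So one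
   has to bound the latter average below, and then to find a good [t].

   Lower bound.  Let [x_k] be [x] with all columns of index [>= k] replaced by
   those of the identity.  Then [x_(k+1) = v h] with [h = x_k] and [v] in the
   abelian group [W] of column [k], and [(v h)^2 = c(v) h^2] where
   [c : W -> W] is a homomorphism depending on [h].  Averaging over [v] gives
   [M phi (x_(k+1)^2) >= M (phi (x_k^2)^2)]: with [D = h^-1 A \cap h A], the
   average over [v] of [phi (c(v) h^2)] is at least that of
   [m (D \cap c'(v) D)] for some homomorphism [c'], which is at least
   [(m D)^2 = phi (h^2)^2].  Jensen's inequality and induction on [k] give the
   exponent [2 ^ (n-1)].

   The average over [v] is only available jointly with [h].  It is separated,
   one coordinate of [v] at a time, by comparing it with finite averages over
   translations chosen uniformly in [h]; these exist because the means over a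
   coordinate of [v] and over a column of [h] can be exchanged on functions
   [phi (beta (a, b) + gamma a)] with [beta] biadditive, [gamma] additive and
   [phi] positive definite.

   Choice of [t].  Since [m] is only finitely additive, [t] is obtained as a
   limit along an ultrafilter of points of a decreasing sequence of sets of
   positive mean, on which more and more of the densities are large. *)

From HB Require Import structures.
Require Import Defs.
From mathcomp Require Import all_boot all_order all_algebra.
From mathcomp Require Import finmap.
From mathcomp Require Import all_classical all_reals all_analysis.
From mathcomp Require Import ring lra.
Import Order.TTheory GRing.Theory Num.Theory.
Import numFieldNormedType.Exports.
Set Implicit Arguments.
Unset Strict Implicit.
Unset Printing Implicit Defensive.

Local Open Scope classical_set_scope.
Local Open Scope card_scope.
Local Open Scope ring_scope.

(** * Means *)

Section Means.
Context (K : realType).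

Definition bddf (T : Type) (f : T -> K) := exists C, forall x, `|f x| <= C.

Lemma bddf_cst T (c : K) : @bddf T (fun=> c).
Proof. by exists `|c|. Qed.

Lemma bddfD T (f g : T -> K) : bddf f -> bddf g -> bddf (fun x => f x + g x).
Proof.
move=> [C hC] [D hD]; exists (C + D) => x.
by rewrite (le_trans (ler_normD _ _))// lerD.
Qed.

Lemma bddfM T (f g : T -> K) : bddf f -> bddf g -> bddf (fun x => f x * g x).
Proof.
move=> [C hC] [D hD]; exists (C * D) => x.
by rewrite normrM ler_pM.
Qed.

Lemma bddfN T (f : T -> K) : bddf f -> bddf (fun x => - f x).
Proof. by move=> [C hC]; exists C => x; rewrite normrN. Qed.

Lemma bddfX T (f : T -> K) n : bddf f -> bddf (fun x => f x ^+ n).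
Proof. by move=> [C hC]; exists (C ^+ n) => x;
  rewrite normrX lerXn2r// nnegrE (le_trans _ (hC x)). Qed.

Lemma bddf_sum T I (s : seq I) (f : I -> T -> K) :
  (forall i, bddf (f i)) -> bddf (fun x => \sum_(i <- s) f i x).
Proof.
move=> bf; elim: s => [|i s IH].
  by exists 0 => x; rewrite big_nil normr0.
have [C hC] := bddfD (bf i) IH.
by exists C => x; rewrite big_cons.
Qed.

Definition avg (I : Type) (s : seq I) (f : I -> K) : K :=
  (\sum_(a <- s) f a) / (size s)%:R.

Lemma bddf_avg T I (s : seq I) (f : I -> T -> K) :
  (forall i, bddf (f i)) -> bddf (fun x => avg s (f ^~ x)).
Proof. by move=> bf; apply: bddfM; [exact: bddf_sum|exact: bddf_cst]. Qed.

Lemma bddf_comp T T' (g : T' -> T) (f : T -> K) :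
  bddf f -> bddf (fun x => f (g x)).
Proof. by move=> [C hC]; exists C. Qed.

(** A finitely additive mean. [mean_fun] is total, but its values are constrained on bounded
    functions only. *)
Record mean (T : Type) := Mean {
  mean_fun :> (T -> K) -> K ;
  mean_add : forall f g, bddf f -> bddf g ->
    mean_fun (fun x => f x + g x) = mean_fun f + mean_fun g ;
  mean_scale : forall c f, bddf f -> mean_fun (fun x => c * f x) = c * mean_fun
    f ;
  mean_pos : forall f, bddf f -> (forall x, 0 <= f x) -> 0 <= mean_fun f ;
  mean_one : mean_fun (fun=> 1) = 1 }.

Section MeanTheory.
Context (T : Type) (M : mean T).
Implicit Types (f g : T -> K).

Lemma mean_cst c : M (fun=> c) = c.
Proof.
have := mean_scale M c (bddf_cst T 1).
by rewrite mean_one mulr1 => h; rewrite -[RHS]h; congr (M _); apply/funext => x;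
  rewrite mulr1.
Qed.

Lemma meanN f : bddf f -> M (fun x => - f x) = - M f.
Proof.
move=> bf; rewrite -mulN1r -mean_scale//.
by congr (M _); apply/funext => x; rewrite mulN1r.
Qed.

Lemma meanB f g : bddf f -> bddf g -> M (fun x => f x - g x) = M f - M g.
Proof. by move=> bf bg; rewrite mean_add ?meanN//; exact: bddfN. Qed.

Lemma mean_le f g : bddf f -> bddf g -> (forall x, f x <= g x) -> M f <= M g.
Proof.
move=> bf bg fg; rewrite -subr_ge0 -meanB//; apply: mean_pos => [|x].
  by apply: bddfD => //; exact: bddfN.
by rewrite subr_ge0.
Qed.

Lemma mean_norm f C : (forall x, `|f x| <= C) -> `|M f| <= C.
Proof.
move=> fC; have bf : bddf f by exists C.
rewrite ler_norml -(mean_cst C) -meanN ?mean_le//; try exact: bddf_cst.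
- by move=> x; have := fC x; rewrite ler_norml => /andP[].
- by move=> x; have := fC x; rewrite ler_norml => /andP[].
Qed.

Lemma mean_sum I (s : seq I) (f : I -> T -> K) : (forall i, bddf (f i)) ->
  M (fun x => \sum_(i <- s) f i x) = \sum_(i <- s) M (f i).
Proof.
move=> bf; elim: s => [|i s IH].
  by rewrite big_nil -[RHS]mean_cst; congr (M _); apply/funext => x;
    rewrite big_nil.
rewrite big_cons -IH -mean_add//; last exact: bddf_sum.
by congr (M _); apply/funext => x; rewrite big_cons.
Qed.

Lemma mean_avg I (s : seq I) (f : I -> T -> K) : (forall i, bddf (f i)) ->
  M (fun x => avg s (f ^~ x)) = avg s (fun i => M (f i)).
Proof.
move=> bf; rewrite /avg [RHS]mulrC -mean_sum// -mean_scale;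
  last exact: bddf_sum.
by congr (M _); apply/funext => x; rewrite mulrC.
Qed.

(** Expand the mean of [(f - M f)^2], which is nonnegative. *)
Lemma mean_sqr_le f : bddf f -> M f ^+ 2 <= M (fun x => f x ^+ 2).
Proof.
move=> bf; have : 0 <= M (fun x => f x ^+ 2 - (2 * M f) * f x + M f ^+ 2).
  apply: mean_pos => [|x].
    apply: bddfD; last exact: bddf_cst.
    apply: bddfD; first exact: bddfX.
    by apply/bddfN/bddfM => //; exact: bddf_cst.
  by rewrite (_ : _ + _ = (f x - M f) ^+ 2) ?sqr_ge0//; ring.
have b2 : bddf (fun x => f x ^+ 2) by exact: bddfX.
have bc : bddf (fun x => 2 * M f * f x) by apply: bddfM => //; exact: bddf_cst.
rewrite mean_add; last 2 first.
- by apply: bddfD => //; exact: bddfN.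
- exact: bddf_cst.
rewrite meanB// mean_scale// mean_cst => h; rewrite -subr_ge0.
by apply: le_trans h _; rewrite le_eqVlt; apply/orP; left; apply/eqP; ring.
Qed.

Lemma mean_exists_le f e : bddf f -> 0 < e -> exists x, f x <= M f + e.
Proof.
move=> bf e0; apply: contrapT => /forallNP fe.
have : M f + e <= M f.
  rewrite -[leLHS]mean_cst; apply: mean_le => //; first exact: bddf_cst.
  by move=> x; have /negP := fe x; rewrite -ltNge => /ltW.
by rewrite gerDl leNgt e0.
Qed.

End MeanTheory.

Definition map_mean T T' (h : T -> T') (M : mean T) : mean T'.
Proof.
exists (fun f => M (fun t => f (h t))).
- by move=> f g bf bg; rewrite mean_add//; exact: bddf_comp.
- by move=> c f bf; rewrite mean_scale//; exact: bddf_comp.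
- by move=> f bf f0; apply: mean_pos => //; exact: bddf_comp.
- exact: mean_one.
Defined.

Lemma bddf_mean T T' (M : mean T) (f : T' -> T -> K) C :
  (forall x y, `|f x y| <= C) -> bddf (fun x => M (f x)).
Proof. by move=> fC; exists C => x; exact: mean_norm. Qed.


End Means.

(** * Dominated functions *)

Section Averages.
Context (K : realType) (I : Type).
Implicit Types (s : seq I) (f g : I -> K).

Lemma avgD s f g : avg s (fun i => f i + g i) = avg s f + avg s g.
Proof. by rewrite /avg big_split mulrDl. Qed.

Lemma avgZ s c f : avg s (fun i => c * f i) = c * avg s f.
Proof. by rewrite /avg -mulr_sumr mulrA. Qed.

Lemma avgB s f g : avg s (fun i => f i - g i) = avg s f - avg s g.
Proof. by rewrite /avg sumrB mulrBl. Qed.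

Lemma avg_cst s c : (0 < size s)%N -> avg s (fun=> c) = c :> K.
Proof.
move=> s0; rewrite /avg big_const_seq count_predT iter_addr_0 -[c *+ _]mulr_natr
  mulfK//.
by rewrite pnatr_eq0 -lt0n.
Qed.

Lemma le_avg s f g : (forall i, f i <= g i) -> avg s f <= avg s g.
Proof. by move=> fg; rewrite ler_wpM2r ?invr_ge0// ler_sum. Qed.

Lemma avg_norm s f C : (0 < size s)%N -> (forall i,
  `|f i| <= C) -> `|avg s f| <= C.
Proof.
move=> s0 fC; rewrite ler_norml -(avg_cst C s0); apply/andP; split.
  rewrite -mulN1r -avgZ; apply: le_avg => i; rewrite mulN1r.
  by have := fC i; rewrite ler_norml => /andP[].
by apply: le_avg => i; have := fC i; rewrite ler_norml => /andP[].
Qed.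

Lemma avg_exchange J s (t : seq J) (f : I -> J -> K) :
  avg s (fun i => avg t (f i)) = avg t (fun j => avg s (f ^~ j)).
Proof.
by rewrite /avg -!mulr_suml exchange_big /= mulrAC.
Qed.

Lemma avg_sqr s f : avg s f ^+ 2 = avg s (fun i => avg s (fun j => f i * f j)).
Proof.
rewrite expr2 {1}/avg -mulrA mulrC -mulrA [X in _ = X]/avg mulrC; congr (_ / _).
rewrite mulrC mulr_suml; apply: eq_bigr => i _.
by rewrite avgZ mulrC.
Qed.

Lemma avg_map J s (h : I -> J) (f : J -> K) : avg (map h s) f = avg s (f \o h).
Proof. by rewrite /avg big_map size_map. Qed.

End Averages.

Section Domination.
Context (K : realType).

Definition mean_invariant (A : zmodType) (M : mean K A) :=
  forall a f, bddf f -> M (fun x => f (a + x)) = M f.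

(** For [k a = <U_a x, x>] this is the squared norm of the average of the vectors [U_a x] over
    [s]. *)
Definition avg2 (A : zmodType) (s : seq A) (k : A -> K) : K :=
  avg s (fun a => avg s (fun b => k (a - b))).

Lemma avg2_swap (A : zmodType) (s : seq A) k :
  avg2 s k = avg2 s (fun a => k (- a)).
Proof.
rewrite /avg2 avg_exchange; congr (avg s _); apply/funext => a.
by congr (avg s _); apply/funext => b; rewrite opprB.
Qed.

Lemma avg2_map (A B : zmodType) (h : A -> B) (s : seq A) k :
  {morph h : x y / x - y} -> avg2 (map h s) k = avg2 s (k \o h).
Proof.
move=> hB; rewrite /avg2 avg_map; congr (avg s _); apply/funext => a /=.
by rewrite avg_map; congr (avg s _); apply/funext => b /=; rewrite hB.
Qed.

(** Greedy choice: the mean over [v] of the sum of the [w (v - b)] is [k * M w], so some new point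
    [v] exceeds it by at most [k * e]. Evenness doubles these cross terms, and each point adds one
    diagonal term [w 0]. *)
Lemma gillis_sum (A : zmodType) (M : mean K A) (w : A -> K) e k :
  mean_invariant M -> bddf w -> (forall a, w (- a) = w a) -> 0 < e ->
  exists s : seq A, size s = k /\
    \sum_(a <- s) \sum_(b <- s) w (a - b)
      <= k%:R * w 0 + k%:R * (k%:R - 1) * (M w + e).
Proof.
move=> Mi bw we e0; elim: k => [|k [s [sk IH]]].
  by exists [::]; rewrite big_nil !mul0r addr0.
have bw' b : bddf (fun v => w (v - b)) by exact: (bddf_comp (fun v => v - b)).
have [v hv] : exists v, \sum_(b <- s) w (v - b) <= k%:R * (M w + e).
  have [k0|k0] := posnP k.
    by exists 0; rewrite k0 mul0r; move: sk; rewrite k0 => /size0nil ->;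
      rewrite big_nil.
  have ke0 : 0 < k%:R * e by rewrite mulr_gt0// ltr0n.
  have bs : bddf (fun v => \sum_(b <- s) w (v - b)) by apply: bddf_sum.
  have [v hv] := mean_exists_le M bs ke0.
  exists v; apply: le_trans hv _; rewrite mulrDr lerD2r mean_sum//.
  rewrite (eq_bigr (fun=> M w)); last first.
    by move=> b _; rewrite -[RHS](Mi (- b))//; congr (M _); apply/funext => a;
      rewrite addrC.
  by rewrite big_const_seq count_predT iter_addr_0 sk mulr_natl.
exists (v :: s); split; first by rewrite /= sk.
rewrite big_cons big_cons subrr.
under [X in _ + X <= _]eq_bigr do rewrite big_cons.
rewrite big_split /=.
have -> : \sum_(i <- s) w (i - v) = \sum_(i <- s) w (v - i).
  by apply: eq_bigr => i _; rewrite -we opprB.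
rewrite -[k.+1]addn1 natrD.
move: IH hv; set X := \sum_(a <- s) _; set Y := \sum_(b <- s) _ => IH hv.
set m := M w + e in IH hv *; set w0 := w 0 in IH *; set c := k%:R in IH hv *.
lra.
Qed.

Lemma gillis (A : zmodType) (M : mean K A) (w : A -> K) e :
  mean_invariant M -> bddf w -> (forall a, w (- a) = w a) -> 0 < e ->
  exists s : seq A, (0 < size s)%N /\ avg2 s w <= M w + e.
Proof.
move=> Mi bw we e0.
have e2 : 0 < e / 2 by rewrite divr_gt0.
(* With this size the diagonal contributes at most [e / 2] to the average; the other half is the
   slack of the greedy choice. *)
pose k := (Num.truncn (`|w 0 - (M w + e / 2)| / (e / 2))).+1.
have [s [sk hs]] := gillis_sum k Mi bw we e2.
exists s; split; first by rewrite sk.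
have k0 : 0 < k%:R :> K by rewrite ltr0n.
have -> : avg2 s w = (\sum_(a <- s) \sum_(b <- s) w (a - b)) / k%:R / k%:R.
  by rewrite /avg2 /avg -mulr_suml sk.
rewrite !ler_pdivrMr//; apply: le_trans hs _.
have hk : `|w 0 - (M w + e / 2)| <= k%:R * (e / 2).
  by rewrite -ler_pdivrMr// ltW// truncnS_gt.
have := le_trans (ler_norm _) hk.
rewrite -(ler_pM2l k0).
set m := M w in hk *; set w0 := w 0 in hk *; set c := k%:R in hk k0 *.
by lra.
Qed.

(* [dominated k u] holds when [u a = <U_a x, y>] and [k a = <U_a x, x>] for a
   unitary representation [U] and [`|y| <= 1]: the left-hand side is the square
   of [<z - U_d z, y>] with [z = avg_(a <- s) U_(w + a) x]. *)
Definition dominated (A : zmodType) (k u : A -> K) :=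
  forall (s : seq A) (d w : A), (0 < size s)%N ->
    avg s (fun a => u (w + a) - u (w + a + d)) ^+ 2
      <= 2 * (avg2 s k - avg2 s (fun a => k (a + d))).

(** A consequence of positive definiteness: for [k a = <U_a x, x>] it reads [<U_d z, z> <= <z, z>]
    with [z] the average of the [U_a x] over [s]. *)
Definition psd (A : zmodType) (k : A -> K) :=
  forall (s : seq A) (d : A), (0 < size s)%N ->
    avg2 s (fun a => k (a + d)) <= avg2 s k.

Lemma dominated_psd (A : zmodType) (k u : A -> K) : dominated k u -> psd k.
Proof.
move=> ku s d s0; rewrite -subr_ge0 -(pmulr_rge0 _ (@ltr0n K 2)).
exact: le_trans (sqr_ge0 _) (ku s d 0 s0).
Qed.

(** The bound in [dominated] is uniform in the base point [w], so it holds for each translate by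
    [t x]; Jensen's inequality passes it to the mean. *)
Lemma dominated_mean (A : zmodType) T (M : mean K T) (k u : A -> K) (t :
  T -> A) :
  bddf u -> dominated k u -> dominated k (fun a => M (fun x => u (a + t x))).
Proof.
move=> [C uC] ku s d w s0.
have bu a : bddf (fun x => u (a + t x)) by exists C.
have b1 a : bddf (fun x => u (w + a + t x) - u (w + a + d + t x)).
  by apply: bddfD => //; exact: bddfN.
rewrite (_ : avg s _ =
    M (fun x => avg s (fun a => u (w + a + t x) - u (w + a + d + t x))));
      last first.
  by rewrite mean_avg//; congr (avg s _); apply/funext => a; rewrite meanB.
apply: le_trans (mean_sqr_le _ _) _; first exact: bddf_avg.
rewrite -[leRHS](mean_cst M); apply: mean_le => [| |x].
- by apply/bddfX/bddf_avg.
- exact: bddf_cst.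
- have := ku s d (w + t x) s0; congr (_ ^+ 2 <= _); congr (avg s _).
  by apply/funext => a; rewrite [w + t x + a]addrAC [w + a + t x + d]addrAC.
Qed.

(** Restriction of the representation along [h]; the offset [w] joins the base point. *)
Lemma dominated_comp (A B : zmodType) (k u : B -> K) (h : A -> B) w :
  {morph h : x y / x + y} -> dominated k u -> dominated (k \o h) (fun a => u (w
    + h a)).
Proof.
move=> hD ku s d v s0.
have h0 : h 0 = 0 by apply: (addrI (h 0)); rewrite -hD !addr0.
have hN a : h (- a) = - h a by apply: (addrI (h a)); rewrite -hD !subrr.
have hB : {morph h : x y / x - y} by move=> x y; rewrite hD hN.
have s0' : (0 < size (map h s))%N by rewrite size_map.
have := ku (map h s) (h d) (w + h v) s0'.
rewrite avg_map !avg2_map//; congr (_ ^+ 2 <= _ * (_ - avg2 s _)); last first.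
  by apply/funext => a /=; rewrite hD.
by congr (avg s _); apply/funext => a /=; rewrite !hD !addrA.
Qed.

(** Average the inequality of [psd] over [d]: by invariance each [k (a - b + d)] has mean [M k]. *)
Lemma psd_mean_le (A : zmodType) (M : mean K A) (k : A -> K) s :
  mean_invariant M -> bddf k -> psd k -> (0 < size s)%N -> M k <= avg2 s k.
Proof.
move=> Mi bk ks s0.
have bk' c : bddf (fun a => k (c + a)) by exact: (bddf_comp (fun a => c + a)).
rewrite -[leRHS](mean_cst M).
apply: le_trans (_ : M (fun d => avg2 s (fun a => k (a + d))) <= _); last first.
  apply: mean_le => [||d]; [|exact: bddf_cst|exact: ks].
  by apply: bddf_avg => a; apply: bddf_avg.
rewrite /avg2 mean_avg; last by move=> a; exact: bddf_avg.
rewrite -[leLHS](@avg_cst K _ s)//; apply: le_avg => a.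
rewrite mean_avg// -[leLHS](@avg_cst K _ s)//; apply: le_avg => b.
by rewrite Mi.
Qed.

(** The difference [avg s u - M u] is the mean over [d] of [z d], whose square [dominated] bounds.
    Thus a list [s] with [avg2 s k] close to [M k] serves for every [u] dominated by [k]. *)
Lemma dominated_approx (A : zmodType) (M : mean K A) (k u : A -> K) s e :
  mean_invariant M -> bddf k -> bddf u -> dominated k u -> (0 < size s)%N -> 0 <
    e ->
  M u - e - (2 / e) * (avg2 s k - M k) <= avg s u.
Proof.
move=> Mi bk bu ku s0 e0.
have bu' c : bddf (fun a => u (c + a)) by exact: (bddf_comp (fun a => c + a)).
have bk' c : bddf (fun a => k (c + a)) by exact: (bddf_comp (fun a => c + a)).
pose z d := avg s (fun a => u a - u (a + d)).
have bz1 a : bddf (fun d => u a - u (a + d)).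
  by apply: bddfD; [exact: bddf_cst|exact: bddfN].
have bz : bddf z by apply: bddf_avg.
have Mz : M z = avg s u - M u.
  rewrite mean_avg// -[in RHS](@avg_cst K _ s (M u))// -avgB.
  congr (avg s _); apply/funext => a.
  by rewrite meanB ?mean_cst ?Mi//; exact: bddf_cst.
pose g d := - (e + (2 / e) * (avg2 s k - avg2 s (fun a => k (a + d)))).
have b2 : bddf (fun d => avg2 s (fun a => k (a + d))).
  by apply: bddf_avg => a; exact: bddf_avg.
have b3 : bddf (fun d => avg2 s k - avg2 s (fun a => k (a + d))).
  by apply: bddfD; [exact: bddf_cst|exact: bddfN].
have b4 : bddf (fun d => 2 / e * (avg2 s k - avg2 s (fun a => k (a + d)))).
  by apply: bddfM => //; exact: bddf_cst.
have : M g <= M z.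
  apply: mean_le => // [|d].
    by apply/bddfN/bddfD => //; exact: bddf_cst.
  have := ku s d 0 s0.
  rewrite (_ : avg s _ = z d); last first.
    by congr (avg s _); apply/funext => a; rewrite add0r.
  move=> h; rewrite /g lerNl -(ler_pM2r e0) mulrDl.
  rewrite [2 / e * _ * _]mulrAC divfK ?gt_eqF//.
  (* Linearises the quadratic bound, through [- e * z <= e^2 + z^2], so that means can be taken. *)
  apply: le_trans (_ : e * e + z d ^+ 2 <= _); last by rewrite lerD2l.
  by nra.
rewrite Mz /g meanN; last by apply: bddfD => //; exact: bddf_cst.
rewrite mean_add ?mean_cst ?mean_scale//; last exact: bddf_cst.
rewrite meanB ?mean_cst//; last exact: bddf_cst.
have -> : M (fun d => avg2 s (fun a => k (a + d))) = M k.
  rewrite /avg2 mean_avg; last by move=> a; exact: bddf_avg.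
  rewrite -[RHS](@avg_cst K _ s)//; congr (avg s _); apply/funext => a.
  rewrite mean_avg// -[RHS](@avg_cst K _ s)//; congr (avg s _);
    apply/funext => b.
  by rewrite Mi.
by lra.
Qed.

End Domination.

(** * Exchange of two means on functions positive definite in one variable *)

Section Exchange.
Context (K : realType) (A : zmodType) (B : Type).
Context (MA : mean K A) (MB : mean K B) (MAi : mean_invariant MA).
Implicit Type k : A -> B -> K.

Lemma mean_avg2 (s : seq A) k : (forall a, bddf (k a)) ->
  MB (fun b => avg2 s (k ^~ b)) = avg2 s (fun a => MB (k a)).
Proof.
move=> bk; rewrite /avg2 mean_avg; last by move=> a; apply: bddf_avg.
by congr (avg s _); apply/funext => a; rewrite mean_avg.
Qed.

(** [gillis] replaces the outer mean over [A] by a finite average, which commutes with [MB] and, by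
    [psd_mean_le], dominates each inner mean. *)
Lemma exchange_psd k C : (forall a b, `|k a b| <= C) ->
  (forall a b, k (- a) b = k a b) -> (forall b, psd (k ^~ b)) ->
  MB (fun b => MA (k ^~ b)) <= MA (fun a => MB (k a)).
Proof.
move=> kC ke kp.
have bA b : bddf (k ^~ b) by exists C.
have bB a : bddf (k a) by exists C.
have bMB : bddf (fun a => MB (k a)) by apply: (bddf_mean _ kC).
have bMA : bddf (fun b => MA (k ^~ b)) by apply:
  (@bddf_mean _ _ _ _ _ C) => b a.
apply/ler_addgt0Pr => e e0.
have we a : MB (k (- a)) = MB (k a) by congr (MB _); apply/funext => b.
have [s [s0 hs]] := gillis MAi bMB we e0.
apply: le_trans hs.
rewrite -mean_avg2//; apply: mean_le => // [|b]; first by apply: bddf_avg => a;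
  apply: bddf_avg.
exact: psd_mean_le.
Qed.

(** The assumed inequality of means makes a single list nearly optimal on average over [b], although
    it is chosen for the kernel averaged over [b]. *)
Lemma uniform_avg2 k C e : (forall a b, `|k a b| <= C) ->
  (forall a b, k (- a) b = k a b) ->
  MA (fun a => MB (k a)) <= MB (fun b => MA (k ^~ b)) -> 0 < e ->
  exists s : seq A, (0 < size s)%N /\
    MB (fun b => avg2 s (k ^~ b)) <= MB (fun b => MA (k ^~ b)) + e.
Proof.
move=> kC ke kAB e0.
have bB a : bddf (k a) by exists C.
have bMB : bddf (fun a => MB (k a)) by apply: (bddf_mean _ kC).
have we a : MB (k (- a)) = MB (k a) by congr (MB _); apply/funext => b.
have [s [s0 hs]] := gillis MAi bMB we e0.
exists s; split => //; apply: le_trans (_ : MA (fun a => MB (k a)) + e <= _).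
  by rewrite mean_avg2.
by rewrite lerD2r.
Qed.

End Exchange.

(** * Exchange of means for biadditive plus additive phases *)

Section ExchangeBilinear.
Context (K : realType) (A B W : zmodType) (Y : Type) (y : Y -> B).
Context (MA : mean K A) (MAi : mean_invariant MA) (MB : mean K Y).
Context (MBi : forall b (f : B -> K),
  bddf f -> MB (fun t => f (b + y t)) = MB (fun t => f (y t))).
Context (phi : W -> K) (bphi : bddf phi) (phie : forall w, phi (- w) = phi w).
Context (phi_dominated : dominated phi phi).
Context (beta : A -> B -> W) (gamma : A -> W).
Context (betaDl : forall b, {morph beta^~ b : a a' / a + a'}).
Context (betaDr : forall a, {morph beta a : b b' / b + b'}).
Context (gammaD : {morph gamma : a a' / a + a'}).

Let morph0 (U V : zmodType) (h : U -> V) : {morph h : a b / a + b} -> h 0 = 0.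
Proof. by move=> hD; apply: (addrI (h 0)); rewrite -hD !addr0. Qed.

Let morphN (U V : zmodType) (h : U -> V) :
  {morph h : a b / a + b} -> {morph h : a / - a}.
Proof. by move=> hD a; apply: (addrI (h a)); rewrite -hD !subrr morph0. Qed.

Let pushB : mean K B := map_mean y MB.

(* The functional [MB o MA] is itself a joint invariant mean, so it may be
   averaged over finitely many translations in [b] chosen uniformly well in [a];
   such translations exist by [exchange_psd] with [A] and [B] swapped. *)
Lemma exchange_affine :
  MA (fun a => MB (fun t => phi (beta a (y t) + gamma a)))
    <= MB (fun t => MA (fun a => phi (beta a (y t) + gamma a))).
Proof.
have [C phiC] := bphi.
have iB : mean_invariant pushB by move=> b f bf; exact: MBi.
have cphi T (g : T -> W) : bddf (fun t => phi (g t)) by exact: bddf_comp.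
have bMA (g : B -> A -> W) : bddf (fun b => MA (fun a => phi (g b a))).
  by apply: (@bddf_mean _ _ _ _ _ C).
have bMB (g : A -> B -> W) : bddf (fun a => pushB (fun b => phi (g a b))).
  by apply: (@bddf_mean _ _ _ _ _ C).
pose k b a := phi (beta a b).
(* The exchange without [gamma]: this is the hypothesis of [uniform_avg2] with the two groups
   interchanged. *)
have kAB : pushB (fun b => MA (k b)) <= MA (fun a => pushB (k ^~ a)).
  apply: (@exchange_psd K A B MA pushB MAi (fun a b => k b a) C).
  - by move=> a b; exact: phiC.
  - by move=> a b; rewrite /k (morphN (betaDl b)) phie.
  move=> b; apply: (@dominated_psd _ _ _ (fun a => phi (0 + beta a b))).
  exact: (dominated_comp 0 (betaDl b) phi_dominated).
change (MA (fun a => pushB (fun b => phi (beta a b + gamma a)))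
    <= pushB (fun b => MA (fun a => phi (beta a b + gamma a)))).
apply/ler_addgt0Pr => e e0.
have e2 : 0 < e / 2 by rewrite divr_gt0.
(* The factor [2 / (e / 2)] of [dominated_approx] turns this slack into [e / 2]. *)
have n0 : 0 < (e / 2) ^+ 2 / 2 by rewrite divr_gt0// exprn_gt0.
have kE b a : k (- b) a = k b a by rewrite /k (morphN (betaDr a)) phie.
have [s [s0 hs]] := @uniform_avg2 K B A pushB MA iB k C _
  (fun b a => phiC _) kE kAB n0.
pose u a b := phi (beta a b + gamma a).
have uE : pushB (fun b => MA (u ^~ b))
    = pushB (fun b => MA (fun a => avg s (fun b' => u a (b' + b)))).
  have h b' : pushB (fun b => MA (u ^~ (b' + b))) = pushB (fun b => MA (u ^~
    b)).
    by apply: (iB b' (fun b => MA (u ^~ b))); exact: bMA.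
  transitivity (pushB (fun b => avg s (fun b' => MA (u ^~ (b' + b)))));
    last first.
    by congr (pushB _); apply/funext => b; rewrite mean_avg// => b';
      exact: cphi.
  rewrite mean_avg; last by move=> b';
    exact: (bMA (fun b a => beta a (b' + b) + gamma a)).
  by rewrite -[LHS](@avg_cst K _ s)//; congr (avg s _); apply/funext => b';
    rewrite h.
rewrite -/(u _ _) uE.
have bavg : bddf (fun a => avg2 s (k ^~ a)).
  by apply: bddf_avg => b1; apply: bddf_avg => b2; exact: cphi.
(* For fixed [a] the term [gamma a] only moves the base point, so the kernel in [b] is the one
   without [gamma], for which [s] was chosen. *)
have key a b : pushB (u a) - e / 2 - 2 / (e / 2) * (avg2 s (k ^~ a) - pushB (k
  ^~ a))
     <= avg s (fun b' => u a (b' + b)).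
  pose v b' := phi (beta a b + gamma a + beta a b').
  have dv : dominated (k ^~ a) v by exact:
    (dominated_comp _ (betaDr a) phi_dominated).
  have := dominated_approx iB (cphi _ _) (cphi _ _) dv s0 e2.
  have uv b' : u a (b + b') = v b' by rewrite /u /v betaDr addrAC.
  have -> : pushB v = pushB (u a).
    by rewrite -[RHS](iB b (u a) (cphi _ _)); congr (pushB _);
      apply/funext => b'; rewrite uv.
  by have -> : avg s v = avg s (fun b' => u a (b' + b))
    by congr (avg s _); apply/funext => b'; rewrite addrC uv.
have lower b : MA (fun a => pushB (u a)) - e <=
    MA (fun a => avg s (fun b' => u a (b' + b))).
  have b1 : bddf (fun a => pushB (u a)) by exact: bMB.
  have b2 : bddf (fun a => pushB (k ^~ a)) by exact:
    (bMB (fun a b => beta a b)).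
  have b3 : bddf (fun a => avg2 s (k ^~ a) - pushB (k ^~ a)).
    by apply: bddfD; [|exact: bddfN].
  have b4 : bddf (fun a => 2 / (e / 2) * (avg2 s (k ^~ a) - pushB (k ^~ a))).
    by apply: bddfM => //; exact: bddf_cst.
  have b5 : bddf (fun a => pushB (u a) - e / 2).
    by apply: bddfD => //; exact: bddf_cst.
  have b6 : bddf (fun a => pushB (u a) - e / 2
      - 2 / (e / 2) * (avg2 s (k ^~ a) - pushB (k ^~ a))).
    by apply: bddfD => //; exact: bddfN.
  have b7 : bddf (fun a => avg s (fun b' => u a (b' + b))).
    by apply: bddf_avg => b'; exact: cphi.
  apply: le_trans (mean_le MA b6 b7 (key ^~ b)).
  rewrite meanB// meanB//; last exact: bddf_cst.
  rewrite mean_cst mean_scale// meanB//.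
  rewrite -addrA lerD2l -opprD lerN2 [leRHS]splitr lerD2l.
  apply: le_trans (_ : 2 / (e / 2) * ((e / 2) ^+ 2 / 2) <= _).
    by rewrite ler_pM2l ?divr_gt0// lerBlDl.
  by rewrite le_eqVlt; apply/orP; left; apply/eqP; field; rewrite gt_eqF.
rewrite -lerBlDr -[leLHS](mean_cst pushB); apply: mean_le => //.
  exact: bddf_cst.
by apply: (@bddf_mean _ _ _ _ _ C) => b a; apply: avg_norm => // b';
  exact: phiC.
Qed.

Lemma uniform_affine e : 0 < e ->
  exists s : seq A, (0 < size s)%N /\
    MB (fun t => avg2 s (fun a => phi (beta a (y t) + gamma a)))
      <= MB (fun t => MA (fun a => phi (beta a (y t) + gamma a))) + e.
Proof.
have [C phiC] := bphi.
apply: (@uniform_avg2 K A Y MA MB MAi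
  (fun a t => phi (beta a (y t) + gamma a)) C) => //.
- by move=> a t; rewrite (morphN (betaDl _)) (morphN gammaD) -opprD phie.
- exact: exchange_affine.
Qed.

End ExchangeBilinear.

(** * Correlations on a group *)

Section Correlation.
Context (K : realType) (G : groupType) (m : mean K G).

Definition left_invariant := forall g f,
  bddf f -> m (fun t => f (g * t)%g) = m f.

Context (mi : left_invariant).

(** The matrix coefficient of [f] under left translation; for [f = 1_A] it is [m (A \cap g^-1 A)],
    the function [phi] of the overview. *)
Definition corr (f : G -> K) (g : G) : K := m (fun t => f (g * t)%g * f t).

Lemma corrE f g h : bddf f ->
  m (fun t => f (g * t)%g * f (h * t)%g) = corr f (g * h^-1)%g.
Proof.
move=> bf; rewrite /corr -[RHS](mi h); last first.
  by apply: bddfM => //; exact: (bddf_comp (fun t => g * h^-1 * t)%g).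
by congr (m _); apply/funext => t; rewrite -!mulgA mulKg.
Qed.

Lemma corrV f g : bddf f -> corr f g^-1%g = corr f g.
Proof.
move=> bf; rewrite -[g^-1%g]mul1g -corrE//; congr (m _); apply/funext => t.
by rewrite mul1g mulrC.
Qed.

Lemma corr1 f : corr f 1%g = m (fun t => f t ^+ 2).
Proof. by congr (m _); apply/funext => t; rewrite mul1g. Qed.

Lemma corr_le1 f g : (forall t, `|f t| <= 1) -> `|corr f g| <= 1.
Proof. by move=> f1; apply: mean_norm => t; rewrite normrM mulr_ile1. Qed.

Context (W : zmodType) (e : W -> G).
Context (eD : forall w w', e (w + w') = (e w * e w')%g).

Let e0 : e 0 = 1%g.
Proof. by apply: (mulgI (e 0)); rewrite -eD addr0 mulg1. Qed.

Let eN w : e (- w) = (e w)^-1%g.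
Proof. by apply: (mulgI (e w)); rewrite -eD subrr mulgV. Qed.

(** Cauchy-Schwarz for the form [m (f * g)]: by invariance the coefficient at [e (w + a) * g] pairs
    the translate of [f] by [e a] with a function [y] independent of [a] and bounded by 1. *)
Lemma dominated_corr f g : (forall t, `|f t| <= 1) ->
  dominated (fun w => corr f (e w)) (fun w => corr f (e w * g)%g).
Proof.
move=> f1 s d w s0.
have bf : bddf f by exists 1.
have bfc (h : G -> G) : bddf (fun t => f (h t)) by exact: bddf_comp.
pose y t := f (g^-1 * (e w)^-1 * t)%g.
pose z a t := f (e a * t)%g - f (e (a + d) * t)%g.
have by_ : bddf y by exact: bfc.
have bz a : bddf (z a) by apply: bddfD => //; exact: bddfN.
have corr_y a : corr f (e (w + a) * g)%g = m (fun t => f (e a * t)%g * y t).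
  by rewrite corrE// invgM !invgK mulgA -eD addrC.
have -> : avg s (fun a => corr f (e (w + a) * g)%g - corr f (e (w + a + d) *
  g)%g)
     = m (fun t => avg s (z ^~ t) * y t).
  transitivity (avg s (fun a => m (fun t => z a t * y t))).
    congr (avg s _); apply/funext => a; rewrite -addrA !corr_y -meanB;
      try by apply: bddfM => //; exact: bfc.
    by congr (m _); apply/funext => t; rewrite mulrBl.
  transitivity (m (fun t => avg s (fun a => z a t * y t))).
    by rewrite (mean_avg m s (f := fun a t => z a t * y t))// => a;
      exact: bddfM.
  by congr (m _); apply/funext => t; rewrite [RHS]mulrC -avgZ; congr (avg s _);
    apply/funext => a; rewrite mulrC.
have bZ : bddf (fun t => avg s (z ^~ t)) by exact: bddf_avg.
apply: le_trans (mean_sqr_le _ _) _; first exact: bddfM.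
apply: le_trans (_ : m (fun t => avg s (z ^~ t) ^+ 2) <= _).
  apply: mean_le => [||t]; [by apply/bddfX/bddfM|exact: bddfX|].
  rewrite exprMn ler_piMr ?sqr_ge0//.
  by have := f1 (g^-1 * (e w)^-1 * t)%g; rewrite ler_norml -/(y t) => /andP[];
    nra.
rewrite (_ : (fun t => avg s (z ^~ t) ^+ 2) =
    fun t => avg s (fun a => avg s (fun b => z a t * z b t))); last first.
  by apply/funext => t; rewrite avg_sqr.
rewrite mean_avg; last by move=> a; apply: bddf_avg => b; exact: bddfM.
pose k w := corr f (e w).
have kN w' : k (- w') = k w' by rewrite /k eN corrV.
have zE a b : m (fun t => z a t * z b t) = k (a - b) + k (a - b) - k (a - b + d)
  - k (b - a + d).
  have kE a' b' : m (fun t => f (e a' * t)%g * f (e b' * t)%g) = k (a' - b').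
    by rewrite corrE// -eN -eD.
  have bff a' b' : bddf (fun t => f (e a' * t)%g * f (e b' * t)%g) by exact:
    bddfM.
  transitivity (m (fun t => f (e a * t)%g * f (e b * t)%g + f (e (a + d) * t)%g
    * f (e (b + d) * t)%g
       - f (e (a + d) * t)%g * f (e b * t)%g - f (e a * t)%g * f (e (b + d) *
         t)%g)).
    by congr (m _); apply/funext => t; rewrite /z; ring.
  rewrite meanB//; last by apply: bddfD; [exact: bddfD|exact: bddfN].
  rewrite meanB//; last exact: bddfD.
  rewrite mean_add// !kE; congr (_ + k _ - k _ - _).
  - by rewrite opprD addrACA subrr addr0.
  - by rewrite addrAC.
  - by rewrite -kN; congr k; rewrite opprB addrAC.
rewrite le_eqVlt; apply/orP; left; apply/eqP.
transitivity (avg2 s k + avg2 s k - avg2 s (fun a => k (a + d)) - avg2 s (fun a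
  => k (- a + d))).
  rewrite /avg2 -avgD -avgB -avgB; congr (avg s _); apply/funext => a.
  rewrite mean_avg; last by move=> b; exact: bddfM.
  rewrite -avgD -avgB -avgB; congr (avg s _); apply/funext => b.
  by rewrite zE opprB.
have -> : avg2 s (fun a => k (- a + d)) = avg2 s (fun a => k (a + d)).
  by rewrite [RHS]avg2_swap.
by ring.
Qed.

(** Khintchine-type recurrence: for a list [s] given by [gillis], [avg2] is the mean of the square
    of the averaged translates of [f], which is at least [(m f)^2]. *)
Lemma corr_mean_lower (N : mean K W) f : mean_invariant N ->
  (forall t, `|f t| <= 1) -> m f ^+ 2 <= N (fun w => corr f (e w)).
Proof.
move=> Ni f1; have bf : bddf f by exists 1.
have bfc (h : G -> G) : bddf (fun t => f (h t)) by exact: bddf_comp.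
apply/ler_addgt0Pr => r r0.
have bk : bddf (fun w => corr f (e w)) by exists 1 => w; exact: corr_le1.
have kN w' : corr f (e (- w')) = corr f (e w') by rewrite eN corrV.
have [s [s0 hs]] := gillis Ni bk kN r0.
apply: le_trans hs.
have -> : m f = m (fun t => avg s (fun w => f (e w * t)%g)).
  rewrite mean_avg// -[LHS](@avg_cst K _ s)//; congr (avg s _).
  by apply/funext => w; rewrite mi.
have ba : bddf (fun t => avg s (fun w => f (e w * t)%g)) by exact: bddf_avg.
apply: le_trans (mean_sqr_le _ ba) _.
rewrite (_ : (fun t => _ ^+ 2) = fun t => avg s (fun a => avg s
    (fun b => f (e a * t)%g * f (e b * t)%g))); last first.
  by apply/funext => t; rewrite avg_sqr.
rewrite mean_avg; last by move=> a; apply: bddf_avg => b; exact: bddfM.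
apply: le_avg => a; rewrite mean_avg; last by move=> b; exact: bddfM.
by apply: le_avg => b; rewrite corrE// -eN -eD.
Qed.

End Correlation.

(** * Means on a group spanned by coordinates, one coordinate at a time *)

Section CoordinateMean.
Context (K : realType).

Definition dirac_mean T (t : T) : mean K T.
Proof. by exists (fun f => f t) => //; move=> f bf; apply. Defined.

Lemma bddf_shift (A W : zmodType) (MA : mean K A) (i : A -> W) f :
  bddf f -> bddf (fun w => MA (fun a => f (w + i a))).
Proof. by move=> [C fC]; apply: (@bddf_mean _ _ _ _ _ C). Qed.

(** The convolution of [N] with the image of [MA] under [i]. *)
Definition shift_mean (A W : zmodType) (N : mean K W) (MA : mean K A)
  (i : A -> W) : mean K W.
Proof.
exists (fun f => N (fun w => MA (fun a => f (w + i a)))).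
- move=> f g bf bg; rewrite -mean_add; [|exact: bddf_shift|exact: bddf_shift].
  by congr (N _); apply/funext => w; rewrite mean_add//;
    exact: (bddf_comp (fun a => w + i a)).
- move=> c f bf; rewrite -mean_scale; last exact: bddf_shift.
  by congr (N _); apply/funext => w; rewrite mean_scale//;
    exact: (bddf_comp (fun a => w + i a)).
- by move=> f bf f0; apply: mean_pos => [|w];
  [exact: bddf_shift|apply: mean_pos => //;
    exact: (bddf_comp (fun a => w + i a))].
- by rewrite -[RHS](mean_one N); congr (N _); apply/funext => w;
  rewrite mean_one.
Defined.

Context (A W : zmodType) (MA : mean K A) (MAi : mean_invariant MA).
Context (J : eqType) (i : J -> A -> W) (iD : forall j, {morph i j :
  a b / a + b}).

Fixpoint coord_mean (js : seq J) : mean K W :=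
  if js is j :: js' then shift_mean (coord_mean js') MA (i j)
  else dirac_mean 0.

Lemma coord_mean_shift js j a f : j \in js -> bddf f ->
  coord_mean js (fun w => f (i j a + w)) = coord_mean js f.
Proof.
elim: js f => // j' js IH f; rewrite inE => /orP[/eqP <-|jjs] bf; rewrite /=.
  congr (coord_mean js _); apply/funext => w.
  have bfw : bddf (fun a => f (w + i j a)) by exact:
    (bddf_comp (fun a => w + i j a)).
  rewrite -[RHS](MAi a bfw).
  by congr (MA _); apply/funext => a'; rewrite iD addrCA.
rewrite -[RHS](IH (fun w => MA (fun a => f (w + i j' a))))//.
  by congr (coord_mean js _); apply/funext => w; congr (MA _);
    apply/funext => b; rewrite addrA.
by case: bf => [C fC]; apply: (@bddf_mean _ _ _ _ _ C).
Qed.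

Lemma coord_mean_invariant js :
  (forall w, exists a : J -> A, w = \sum_(j <- js) i j (a j)) ->
  mean_invariant (coord_mean js).
Proof.
move=> span w f bf; have [a ->] := span w.
rewrite big_seq; elim/big_ind : _ f bf => [f bf|x y hx hy f bf|j jjs f bf].
- by congr (coord_mean js _); apply/funext => x; rewrite add0r.
- rewrite -[RHS]hx// -[RHS]hy; last exact: (bddf_comp (fun z => x + z)).
  by congr (coord_mean js _); apply/funext => z; rewrite addrA.
- exact: coord_mean_shift.
Qed.

Context (X : Type) (G : Type) (M : mean K X) (h : X -> G) (v : X -> W).
Context (k : X -> W -> K) (bk : exists C, forall x w, `|k x w| <= C).

(** Induct on the coordinates, with [u'] the average of [u] over the current one, still dominated by
    [k x]. The finite list [s] does not depend on [x], so the invariance of [M] under a fixed shift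
    of [v x] applies to it, and [dominated_approx] compares the finite average with [u']. *)
Lemma coord_mean_le js (u : G -> W -> K) C :
  (forall j a (F : G -> W -> K) D, j \in js -> (forall g w, `|F g w| <= D) ->
     M (fun x => F (h x) (v x + i j a)) = M (fun x => F (h x) (v x))) ->
  (forall j r, j \in js -> 0 < r -> exists s : seq A, (0 < size s)%N /\
     M (fun x => avg2 s (fun a => k x (i j a)))
       <= M (fun x => MA (fun a => k x (i j a))) + r) ->
  (forall g w, `|u g w| <= C) -> (forall x, dominated (k x) (u (h x))) ->
  M (fun x => coord_mean js (fun w => u (h x) (v x + w)))
    <= M (fun x => u (h x) (v x)).
Proof.
elim: js u => [|j js IH] u HT HU uC du /=.
  by rewrite le_eqVlt; apply/orP; left; apply/eqP; congr (M _);
    apply/funext => x; rewrite addr0.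
pose u' g w := MA (fun a => u g (w + i j a)).
have u'C g w : `|u' g w| <= C by exact: mean_norm.
have du' x : dominated (k x) (u' (h x)) by apply: dominated_mean => //;
  exists C.
have HT' : forall j a (F : G -> W -> K) D, j \in js ->
    (forall g w, `|F g w| <= D) ->
    M (fun x => F (h x) (v x + i j a)) = M (fun x => F (h x) (v x)).
  by move=> j' a F D j'js; apply: HT; rewrite inE j'js orbT.
have HU' : forall j r, j \in js -> 0 < r -> exists s : seq A, (0 < size s)%N /\
     M (fun x => avg2 s (fun a => k x (i j a)))
       <= M (fun x => MA (fun a => k x (i j a))) + r.
  by move=> j' r j'js; apply: HU; rewrite inE j'js orbT.
apply: le_trans (_ : M (fun x => u' (h x) (v x)) <= _).
  apply: le_trans (IH _ HT' HU' u'C du').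
  rewrite le_eqVlt; apply/orP; left; apply/eqP; congr (M _); apply/funext => x.
  congr (coord_mean js _); apply/funext => w; congr (MA _); apply/funext => a.
  by rewrite addrA.
apply/ler_addgt0Pr => r r0.
have r2 : 0 < r / 2 by rewrite divr_gt0.
have n0 : 0 < (r / 2) ^+ 2 / 2 by rewrite divr_gt0// exprn_gt0.
have [s [s0 hs]] := HU j _ (mem_head _ _) n0.
have [D kD] := bk.
have b1 : bddf (fun x => u' (h x) (v x)) by exists C.
have b2 : bddf (fun x => MA (fun a => k x (i j a))).
  by apply: (@bddf_mean _ _ _ _ _ D).
have b3 : bddf (fun x => avg2 s (fun a => k x (i j a))).
  by apply: bddf_avg => a; apply: bddf_avg => b; exists D.
have b4 : bddf (fun x => avg2 s (fun a => k x (i j a)) - MA (fun a => k x (i j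
  a))).
  by apply: bddfD => //; exact: bddfN.
have b5 : bddf (fun x => 2 / (r / 2) * (avg2 s (fun a => k x (i j a)) - MA (fun
  a => k x (i j a)))).
  by apply: bddfM => //; exact: bddf_cst.
have b6 : bddf (fun x => u' (h x) (v x) - r / 2).
  by apply: bddfD => //; exact: bddf_cst.
have b7 : bddf (fun x => u' (h x) (v x) - r / 2 -
    2 / (r / 2) * (avg2 s (fun a => k x (i j a)) - MA (fun a => k x (i j a)))).
  by apply: bddfD => //; exact: bddfN.
have b8 : bddf (fun x => avg s (fun a => u (h x) (v x + i j a))).
  by apply: bddf_avg => a; exists C.
have -> : M (fun x => u (h x) (v x)) = M (fun x => avg s (fun a => u (h x) (v x
  + i j a))).
  rewrite mean_avg; last by move=> a; exists C.
  rewrite -[LHS](@avg_cst K _ s)//; congr (avg s _); apply/funext => a.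
  by rewrite (HT j a u C)// mem_head.
rewrite -lerBlDr; apply: le_trans (mean_le M b7 b8 _); last first.
  move=> x; apply: (dominated_approx MAi (k := fun a => k x (i j a))) => //.
  - by exists D.
  - by exists C.
  - exact: (dominated_comp _ (iD j) (du x)).
rewrite meanB// meanB//; last exact: bddf_cst.
rewrite mean_cst mean_scale// meanB//.
rewrite -addrA lerD2l -opprD lerN2 [leRHS]splitr lerD2l.
apply: le_trans (_ : 2 / (r / 2) * ((r / 2) ^+ 2 / 2) <= _).
  by rewrite ler_pM2l ?divr_gt0// lerBlDl.
by rewrite le_eqVlt; apply/orP; left; apply/eqP; field; rewrite gt_eqF.
Qed.

End CoordinateMean.

(** * Squares in cosets of an abelian subgroup *)

Section SquareStep.
Context (K : realType) (G : groupType) (m : mean K G) (mi : left_invariant m).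
Context (f : G -> K) (f0 : forall t, 0 <= f t) (f1 : forall t, f t <= 1).
Context (A W : zmodType) (e : W -> G).
Context (eD : forall w w', e (w + w') = (e w * e w')%g).
Context (J : finType) (B : J -> zmodType) (i : J -> A -> W).
Context (iD : forall j, {morph i j : a b / a + b}).
Context (span : forall w, exists a : J -> A, w = \sum_(j <- enum J) i j (a j)).
Context (MA : mean K A) (MAi : mean_invariant MA).
Context (X : Type) (M : mean K X) (h : X -> G) (v : X -> W).
Context (L : G -> W -> W) (LD : forall x, {morph L (h x) : w w' / w + w'}).
Context (eL : forall x w,
  ((e w * h x) * (e w * h x))%g = (e (L (h x) w) * (h x * h x))%g).
Context (vi : forall j a (F : G -> W -> K) D, (forall g w, `|F g w| <= D) ->
  M (fun x => F (h x) (v x + i j a)) = M (fun x => F (h x) (v x))).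
Context (b : forall j, X -> B j) (bi : forall j b0 (F : B j -> K), bddf F ->
  M (fun x => F (b0 + b j x)) = M (fun x => F (b j x))).
Context (beta : forall j, A -> B j -> W) (gamma : J -> A -> W).
Context (betaDl : forall j c, {morph (@beta j)^~ c : a a' / a + a'}).
Context (betaDr : forall j a, {morph @beta j a : c c' / c + c'}).
Context (gammaD : forall j, {morph gamma j : a a' / a + a'}).
Context (Li : forall j a x, L (h x) (i j a) = beta a (b j x) + gamma j a).

Let fn1 t : `|f t| <= 1. Proof. by rewrite ger0_norm. Qed.
Let bf : bddf f. Proof. by exists 1. Qed.

(** When [f = 1_A], [d] is the indicator of [g^-1 A \cap g A], the set [D] of the overview, and [c]
    is the conjugated homomorphism [c']; [corr_mean_lower] applies to this pair. *)
Lemma corr_sqr_lower (N : mean K W) x : mean_invariant N ->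
  corr m f (h x * h x)%g ^+ 2
    <= N (fun w => corr m f ((e w * h x) * (e w * h x))%g).
Proof.
move=> Ni; pose g := h x.
pose d t := f (g * t)%g * f (g^-1 * t)%g.
have bfc (u : G -> G) : bddf (fun t => f (u t)) by exact: bddf_comp.
have d0 t : 0 <= d t by exact: mulr_ge0.
have d1 t : `|d t| <= 1 by rewrite normrM mulr_ile1.
have bd : bddf d by exact: bddfM.
have -> : corr m f (g * g)%g = m d by rewrite /d corrE// invgK.
pose c w := (g^-1 * e (L g w) * g)%g.
have cD w w' : c (w + w') = (c w * c w')%g.
  by rewrite /c LD eD -!mulgA mulVKg.
apply: le_trans (corr_mean_lower mi cD Ni d1) _.
apply: mean_le => [||w]; [by exists 1 => w; exact: corr_le1| |].
  by exists 1 => w; exact: corr_le1.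
have -> : corr m f ((e w * g) * (e w * g))%g
    = m (fun t => f (g * c w * t)%g * f (g^-1 * t)%g).
  by rewrite corrE// invgK eL /c -!mulgA mulVKg.
apply: mean_le => [||t].
- by apply: bddfM => //; exact: (bddf_comp (fun t => c w * t)%g).
- by apply: bddfM; exact: bfc.
(* Two of the four factors of [d (c w * t) * d t] are dropped, being at most 1. *)
- by apply: ler_pM => //; rewrite /d ?mulgA ?mulgA;
  [rewrite ler_piMr|rewrite ler_piMl].
Qed.

(** [corr_sqr_lower] averages over an independent [w], whereas [v x] is tied to [h x];
    [coord_mean_le] bridges the two, with the kernel [phi (L (h x) w)]. *)
Lemma corr_sqr_step :
  M (fun x => corr m f (h x * h x)%g ^+ 2)
    <= M (fun x => corr m f ((e (v x) * h x) * (e (v x) * h x))%g).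
Proof.
have MWi : mean_invariant (coord_mean MA i (enum J)).
  exact: coord_mean_invariant.
pose u g w := corr m f ((e w * g) * (e w * g))%g.
pose phi w := corr m f (e w).
have u1 g w : `|u g w| <= 1 by exact: corr_le1.
have phi1 w : `|phi w| <= 1 by exact: corr_le1.
have e0 : e 0 = 1%g by apply: (mulgI (e 0)); rewrite -eD addr0 mulg1.
have phiN w : phi (- w) = phi w.
  rewrite /phi -(@corrV _ _ _ mi f (e w))//; congr (corr m f _).
  by apply: (mulgI (e w)); rewrite -eD subrr e0 mulgV.
have dphi g : dominated phi (fun w => corr m f (e w * g)%g) by exact:
  dominated_corr.
have dphi1 : dominated phi phi.
  have := dphi 1%g; rewrite (_ : (fun w => _) = phi)//.
  by apply/funext => w; rewrite mulg1.
apply: le_trans (_ : M (fun x => coord_mean MA i (enum J)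
    (fun w => u (h x) (v x + w))) <= _).
  have b1 : bddf (fun x => corr m f (h x * h x)%g ^+ 2).
    by apply: bddfX; exists 1 => x; exact: corr_le1.
  have b2 : bddf (fun x => coord_mean MA i (enum J) (fun w => u (h x) (v x +
    w))).
    by exists 1 => x; exact: mean_norm.
  apply: mean_le => // x.
  rewrite (MWi (v x) (u (h x))); last by exists 1.
  exact: corr_sqr_lower.
apply: (@coord_mean_le K A W MA MAi _ i iD X G M h v (fun x w => phi (L (h x)
  w))
  _ (enum J) u 1) => //.
- by exists 1 => x w; exact: phi1.
- by move=> j a F D _ FD; exact: vi FD.
- move=> j r _ r0.
  have [|s [s0 hs]] := @uniform_affine K A (B j) W X (b j) MA MAi M (@bi j)
    phi _ phiN dphi1 (@beta j) (gamma j) (@betaDl j) (@betaDr j) (@gammaD j) r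
      r0.
    by exists 1.
  exists s; split => //; move: hs.
  have E x : (fun a => phi (L (h x) (i j a))) = fun a => phi (beta a (b j x) +
    gamma j a).
    by apply/funext => a; rewrite Li.
  by under [X in _ -> M X <= _]eq_fun do rewrite E;
     under [X in _ -> _ <= M X + _]eq_fun do rewrite E.
- move=> x.
  have := dominated_comp 0 (@LD x) (dphi (h x * h x)%g).
  rewrite (_ : (fun a => corr m f _) = u (h x))//.
  by apply/funext => w; rewrite add0r /u eL.
Qed.

End SquareStep.

(** * Coordinates of unitriangular matrices *)

Section SubringElements.
Context (S : pzRingType) (R : nonUnitalSubring S).

(** The elements of [R] as a type carrying an additive group, over which means can be invariant; the
    product is a separate operation because [R] may lack a unit. *)
Record subring_elt := SubringElt { subring_val :> S ; _ : subring_val \in R }.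

HB.instance Definition _ := [isSub for subring_val].
HB.instance Definition _ := [Choice of subring_elt by <:].
HB.instance Definition _ := [SubChoice_isSubZmodule of subring_elt by <:].

Definition subring_mul (x y : subring_elt) : subring_elt :=
  SubringElt (rpredM (valP x) (valP y)).

Lemma subring_valD (x y : subring_elt) : val (x + y) = val x + val y.
Proof. exact: raddfD. Qed.

Lemma subring_mulDl x y z :
  subring_mul (x + y) z = subring_mul x z + subring_mul y z.
Proof. by apply: val_inj; rewrite /= mulrDl. Qed.

Lemma subring_mulDr x y z :
  subring_mul x (y + z) = subring_mul x y + subring_mul x z.
Proof. by apply: val_inj; rewrite /= mulrDr. Qed.

End SubringElements.

Section UnitriangularCoordinates.
Context (S : pzRingType) (R : nonUnitalSubring S) (n : nat).
Notation E := (subring_elt R).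
Notation G := (UT R n).
Implicit Types (x y : G).

Lemma UT_diag x i : UT_mx x i i = 1.
Proof. by have /unitriangularP[] := valP x. Qed.

Lemma UT_low x (i j : 'I_n) : (j < i)%N -> UT_mx x i j = 0.
Proof. by have /unitriangularP[_ _] := valP x; apply. Qed.

Lemma UT_up x (i j : 'I_n) : (i < j)%N -> UT_mx x i j \in R.
Proof. by have /unitriangularP[_ + _] := valP x; apply. Qed.

Lemma UT_eqP x y : (forall i j, UT_mx x i j = UT_mx y i j) -> x = y.
Proof. by move=> xy; apply: val_inj; apply/matrixP. Qed.

Definition ext k (w : {ffun 'I_k -> E}) (i : nat) : E :=
  if insub i is Some i' then w i' else 0.

Lemma ext_ord k (w : {ffun 'I_k -> E}) (i : 'I_k) : ext w i = w i.
Proof. by rewrite /ext valK. Qed.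

Lemma ext_out k (w : {ffun 'I_k -> E}) i : (k <= i)%N -> ext w i = 0.
Proof. by rewrite leqNgt /ext => ki; rewrite insubN. Qed.

Lemma extD k (w w' : {ffun 'I_k -> E}) i : ext (w + w') i = ext w i + ext w' i.
Proof.
by rewrite /ext; case: insub => [i'|]; rewrite ?ffunE// addr0.
Qed.

(** For fixed [k] these matrices form the abelian group [W] of the overview; [ext w] vanishes from
    row [k] on, so the diagonal stays 1. *)
Definition ucol_mx (k : 'I_n) (w : {ffun 'I_k -> E}) : 'M[S]_n :=
  \matrix_(i, l) ((i == l)%:R + if l == k then val (ext w i) else 0).

Lemma ucol_subproof (k : 'I_n) w : unitriangular R (@ucol_mx k w).
Proof.
apply/unitriangularP; split=> [i|i l il|i l li]; rewrite mxE.
- by rewrite eqxx; case: eqP => [->|_]; rewrite ?ext_out//= addr0.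
- rewrite -val_eqE ltn_eqF// add0r; case: eqP => _; last exact: rpred0.
  exact: valP.
- rewrite -val_eqE gtn_eqF// add0r; case: eqP => [lk|//].
  by rewrite ext_out//= -lk ltnW.
Qed.

Definition ucol k w : G := MkUT (@ucol_subproof k w).
Arguments ucol : clear implicits.

Lemma UT_mxM x y i l : UT_mx (x * y)%g i l = \sum_j UT_mx x i j * UT_mx y j l.
Proof. by rewrite UT_mulE mxE. Qed.

Lemma ucolM k w x i l :
  UT_mx (ucol k w * x)%g i l = UT_mx x i l + val (ext w i) * UT_mx x k l.
Proof.
rewrite UT_mxM; under eq_bigr do rewrite mxE mulrDl.
rewrite big_split /=; congr (_ + _).
  rewrite (bigD1 i)//= eqxx mul1r big1 ?addr0// => j ji.
  by rewrite eq_sym (negbTE ji) mul0r.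
rewrite (bigD1 k)//= eqxx big1 ?addr0// => j jk.
by rewrite (negbTE jk) mul0r.
Qed.

Lemma ucolD k w w' : ucol k (w + w') = (ucol k w * ucol k w')%g.
Proof.
apply: UT_eqP => i l; rewrite ucolM /= !mxE extD -addrA; congr (_ + _).
rewrite [ext w' k]ext_out// if_same addr0 [k == l]eq_sym.
by case: (l == k); rewrite ?subring_valD ?mulr1 ?mulr0 ?addr0// addrC.
Qed.

(** The element [x_k] of the overview, with columns counted from 0. *)
Definition utrunc_mx (k : nat) x : 'M[S]_n :=
  \matrix_(i, l) if (l < k)%N then UT_mx x i l else (i == l)%:R.

Lemma utrunc_subproof k x : unitriangular R (utrunc_mx k x).
Proof.
apply/unitriangularP; split=> [i|i l il|i l li]; rewrite mxE.
- by rewrite UT_diag eqxx if_same.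
- by case: ifP => _; [exact: UT_up|rewrite -val_eqE ltn_eqF// rpred0].
- by case: ifP => _; [exact: UT_low|rewrite -val_eqE gtn_eqF].
Qed.

Definition utrunc k x : G := MkUT (utrunc_subproof k x).

Lemma utruncE k x i l :
  UT_mx (utrunc k x) i l = if (l < k)%N then UT_mx x i l else (i == l)%:R.
Proof. by rewrite mxE. Qed.

Lemma utrunc_row (k : 'I_n) x l : UT_mx (utrunc k x) k l = (k == l)%:R.
Proof.
rewrite utruncE; case: ifP => // lk; rewrite UT_low//.
by rewrite -val_eqE gtn_eqF.
Qed.

Lemma utrunc_ucol (k : 'I_n) w x : utrunc k (ucol k w * x)%g = utrunc k x :> G.
Proof.
apply: UT_eqP => i l; rewrite !utruncE; case: ifP => // lk.
by rewrite ucolM [UT_mx x k l]UT_low// mulr0 addr0.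
Qed.

(** Column 0 of a unitriangular matrix is already that of the identity, so the induction starts at
    [k = 1] and takes [n - 1] steps. *)
Lemma utrunc1 x : utrunc 1 x = 1%g.
Proof.
apply: UT_eqP => i l; rewrite utruncE [RHS]mxE; case: ltnP => // l1.
have [->|il] := eqVneq i l; first by rewrite UT_diag.
have l0 : l = 0%N :> nat by move: l1; rewrite ltnS leqn0 => /eqP.
by rewrite UT_low// l0 lt0n -l0.
Qed.

Lemma utrunc_all x : utrunc n x = x.
Proof. by apply: UT_eqP => i l; rewrite utruncE ltn_ord. Qed.

(** The default 0 arises when the matrix entry lies outside [R], as may happen on the diagonal; only
    entries above the diagonal are read later. *)
Definition entry x (i l : 'I_n) : E := insubd 0 (UT_mx x i l).

Lemma val_entry x (i l : 'I_n) : (i < l)%N -> val (entry x i l) = UT_mx x i l.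
Proof. by move=> il; rewrite insubdK//; exact: UT_up. Qed.

Definition emb (k : 'I_n) (i : 'I_k) : 'I_n := widen_ord (ltnW (ltn_ord k)) i.

Definition col_of (k : 'I_n) x : {ffun 'I_k -> E} :=
  [ffun i => entry x (emb i) k].

Lemma col_of_ucol (k : 'I_n) w x : col_of k (ucol k w * x)%g = w + col_of k x.
Proof.
apply/ffunP => i; rewrite !ffunE; apply: val_inj; rewrite subring_valD.
rewrite !val_entry; try exact: (ltn_ord i).
by rewrite ucolM UT_diag mulr1 [ext w _](ext_ord w i) addrC.
Qed.

Lemma ucol_utrunc (k : 'I_n) x :
  (ucol k (col_of k x) * utrunc k x)%g = utrunc k.+1 x.
Proof.
apply: UT_eqP => i l; rewrite ucolM utrunc_row !utruncE ltnS [(l <=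
  k)%N]leq_eqVlt -[nat_of_ord l == k]/(l == k).
have [<-|lk] := eqVneq l k.
  rewrite ltnn mulr1 /=; have [ik|ki] := ltnP i l.
    rewrite -val_eqE ltn_eqF// add0r [ext _ _](ext_ord _ (Ordinal ik)) ffunE.
    by rewrite val_entry//; congr (UT_mx x _ _); exact: val_inj.
  rewrite ext_out//= addr0; have [->|il] := eqVneq i l;
    first by rewrite UT_diag.
  by rewrite UT_low// ltn_neqAle ki andbT eq_sym.
by rewrite mulr0 addr0.
Qed.

End UnitriangularCoordinates.

Arguments ucol {S R n} k w.

(** * Squares of unitriangular matrices, column by column *)

Section UnitriangularSquares.
Context (K : realType) (S : pzRingType) (R : nonUnitalSubring S) (n : nat).
Notation E := (subring_elt R).
Notation G := (UT R n).

(** The nilpotent part [h - 1] acting on a column; conjugation by [h = utrunc k x] adds it to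
    [w]. *)
Definition upper_act (k : 'I_n) (h : G) (w : {ffun 'I_k -> E}) :
  {ffun 'I_k -> E} :=
  [ffun i : 'I_k => \sum_(l : 'I_k | (i < l)%N)
     subring_mul (entry h (emb i) (emb l)) (w l)].

Lemma sum_ext (k : 'I_n) (h : G) w (i : 'I_n) :
  \sum_j UT_mx h i j * val (ext w j) = val (ext (w + @upper_act k h w) i).
Proof.
rewrite (bigID (fun j : 'I_n => (j < k)%N)) /= [X in _ + X]big1 ?addr0;
  last first.
  by move=> j; rewrite -leqNgt => kj; rewrite ext_out//= mulr0.
have [ik|ki] := ltnP i k; last first.
  rewrite ext_out//= big1// => j jk.
  by rewrite UT_low ?mul0r// (leq_trans jk).
rewrite (big_ord_narrow (ltnW (ltn_ord k))) (bigD1 (Ordinal ik))//=.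
rewrite [ext (w + _) i](ext_ord _ (Ordinal ik)) !ffunE subring_valD.
congr (_ + _).
  rewrite [ext w _](ext_ord w (Ordinal ik)) (_ :
    widen_ord _ _ = i) ?UT_diag ?mul1r//.
  exact: val_inj.
rewrite (raddf_sum (val : E -> S)) big_mkcond [RHS]big_mkcond.
apply: eq_bigr => l _; rewrite -val_eqE /=.
have [il|li|/esym il] := ltngtP i l.
- rewrite /= [ext w l](ext_ord w l) val_entry//.
  by congr (UT_mx h _ _ * _); exact: val_inj.
- by rewrite /= UT_low ?mul0r.
- by [].
Qed.

(** The homomorphism [c] of the overview: [(v h)^2 = v (h v h^-1) h^2], written additively in
    [W]. *)
Definition square_act (k : 'I_n) (h : G) (w : {ffun 'I_k -> E}) :
  {ffun 'I_k -> E} :=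
  w + (w + upper_act h w).

(** Row [k] of [utrunc k x] is that of the identity, so conjugation by it maps the group of column
    [k] to itself. *)
Lemma utrunc_ucol_comm (k : 'I_n) (x : G) w :
  (utrunc k x * ucol k w)%g = (ucol k (w + upper_act (utrunc k x) w) * utrunc k
    x)%g.
Proof.
apply: UT_eqP => i l; rewrite ucolM utrunc_row -sum_ext UT_mxM.
under eq_bigr do rewrite [UT_mx (ucol k w) _ _]mxE mulrDr.
rewrite big_split /=; congr (_ + _).
  rewrite (bigD1 l)//= eqxx mulr1 big1 ?addr0// => j jl.
  by rewrite (negbTE jl) mulr0.
rewrite mulr_suml [k == l]eq_sym; apply: eq_bigr => j _.
by case: (l == k); rewrite ?mulr1 ?mulr0.
Qed.

Lemma ucol_utrunc_sqr (k : 'I_n) (x : G) w :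
  ((ucol k w * utrunc k x) * (ucol k w * utrunc k x))%g
    = (ucol k (square_act (utrunc k x) w) * (utrunc k x * utrunc k x))%g.
Proof.
rewrite !mulgA -[(ucol k w * utrunc k x * ucol k w)%g]mulgA utrunc_ucol_comm.
by rewrite /square_act [ucol k (w + (w + _))]ucolD !mulgA.
Qed.

Lemma square_actD (k : 'I_n) h : {morph @square_act k h : w w' / w + w'}.
Proof.
move=> w w'; rewrite /square_act.
have -> : upper_act h (w + w') = upper_act h w + upper_act h w'.
  apply/ffunP => i; rewrite !ffunE -big_split; apply: eq_bigr => l _.
  by rewrite ffunE subring_mulDr.
by rewrite [w + w' + (upper_act h w + _)]addrACA [LHS]addrACA.
Qed.

Definition coord (k : 'I_n) (j : 'I_k) (a : E) : {ffun 'I_k -> E} :=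
  [ffun i => if i == j then a else 0].

Lemma coordD k j : {morph @coord k j : a b / a + b}.
Proof. by move=> a b; apply/ffunP => i; rewrite !ffunE; case: eqP => _//;
  rewrite addr0. Qed.

Lemma coord_span (k : 'I_n) (w : {ffun 'I_k -> E}) :
  exists a : 'I_k -> E, w = \sum_(j <- enum 'I_k) coord j (a j).
Proof.
exists w; rewrite big_enum; apply/ffunP => i; rewrite sum_ffunE.
rewrite (bigD1 i)//= big1 ?addr0 ?ffunE ?eqxx// => j ji.
by rewrite ffunE eq_sym (negbTE ji).
Qed.

Definition coord_act (k : 'I_n) (j : 'I_k) (a : E) (c :
  {ffun 'I_(emb j) -> E}) :
  {ffun 'I_k -> E} := [ffun i : 'I_k => subring_mul (ext c i) a].

(** A vector supported on row [j] sees only the entries of [x] in column [j], which truncation keeps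
    because [j < k]; the doubled coordinate is the additive part [gamma]. *)
Lemma square_act_coord (k : 'I_n) (j : 'I_k) a (x : G) :
  square_act (utrunc k x) (coord j a)
    = coord_act a (col_of (emb j) x) + (coord j a + coord j a).
Proof.
rewrite /square_act addrA addrC; congr (_ + _).
apply/ffunP => i; rewrite !ffunE; apply: val_inj.
have [ij|ji] := ltnP i j; last first.
  rewrite ext_out//= mul0r big1// => l il; rewrite ffunE.
  have [lj|_] := eqVneq l j; first by move: il; rewrite lj ltnNge ji.
  by apply: val_inj; rewrite /= mulr0.
rewrite (bigD1 j)//= big1 ?addr0; last first.
  move=> l /andP[_ lj]; rewrite ffunE (negbTE lj).
  by apply: val_inj; rewrite /= mulr0.
rewrite ffunE eqxx; congr (_ * _).
rewrite [ext _ _](ext_ord _ (Ordinal (ij : (i < emb j)%N))) ffunE !val_entry//.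
rewrite utruncE /= ltn_ord; congr (UT_mx x _ _); exact: val_inj.
Qed.

Context (m : mean K G) (mi : left_invariant m).
Context (f : G -> K) (f0 : forall t, 0 <= f t) (f1 : forall t, f t <= 1).
Context (M : mean K G) (Mi : left_invariant M).

Definition entry_mean (i k : 'I_n) : mean K E :=
  map_mean (fun x => entry x i k) M.

Lemma entry_mean_invariant (k : 'I_n) (i : 'I_k) :
  mean_invariant (entry_mean (emb i) k).
Proof.
move=> a g bg; rewrite /= -[RHS](Mi (ucol k (coord i a)));
  last exact: bddf_comp.
congr (M _); apply/funext => x; congr (g _).
have := congr1 (fun w : {ffun 'I_k -> E} => w i) (col_of_ucol (coord i a) x).
by rewrite !ffunE eqxx.
Qed.

Lemma corr_utrunc_step (k : 'I_n) : (0 < k)%N ->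
  M (fun x => corr m f (utrunc k x * utrunc k x)%g) ^+ 2
    <= M (fun x => corr m f (utrunc k.+1 x * utrunc k.+1 x)%g).
Proof.
move=> k0.
have fn1 t : `|f t| <= 1 by rewrite ger0_norm.
apply: le_trans (mean_sqr_le _ _) _; first by exists 1 => x; exact: corr_le1.
have := @corr_sqr_step K G m mi f f0 f1 E {ffun 'I_k -> E} (ucol k)
  (ucolD (k := k)) 'I_k (fun j => {ffun 'I_(emb j) -> E})
  (@coord k) (@coordD k) (@coord_span k) (entry_mean (emb (Ordinal k0)) k)
  (@entry_mean_invariant k (Ordinal k0)) G M (utrunc k) (col_of k)
  (@square_act k) (fun x => @square_actD k (utrunc k x)) (@ucol_utrunc_sqr k) _
  (fun j => col_of (emb j)) _ (@coord_act k) (fun j a => coord j a + coord j a)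
  _ _ _ (fun j a x => @square_act_coord k j a x).
under [X in _ -> _ <= M X]eq_fun do rewrite -ucol_utrunc.
apply.
(* Left multiplication by [ucol k] moves column [k] but fixes the truncation [utrunc k x]. *)
- move=> j a F D FD; rewrite -[RHS](Mi (ucol k (coord j a))); last by exists D.
  by congr (M _); apply/funext => x; rewrite utrunc_ucol col_of_ucol addrC.
- move=> j c F bF; rewrite -[RHS](Mi (ucol (emb j) c)); last exact: bddf_comp.
  by congr (M _); apply/funext => x; rewrite col_of_ucol.
- move=> j c a a'; apply/ffunP => i; rewrite !ffunE; exact: subring_mulDr.
- move=> j a c c'; apply/ffunP => i; rewrite !ffunE extD; exact: subring_mulDl.
- by move=> j a a'; rewrite coordD addrACA.
Qed.

(** Starting from [utrunc 1 x = 1], where the correlation is [m (f^2)], each further column squares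
    the lower bound. *)
Lemma corr_square_lower : (0 < n)%N ->
  m (fun t => f t ^+ 2) ^+ (2 ^ n.-1) <= M (fun x => corr m f (x * x)%g).
Proof.
move=> n0; have mf0 : 0 <= m (fun t => f t ^+ 2).
  by apply: mean_pos => [|t]; [exists 1 => t;
    rewrite ger0_norm ?exprn_ge0// exprn_ile1|exact: sqr_ge0].
have H k : (k < n)%N -> m (fun t => f t ^+ 2) ^+ (2 ^ k)
    <= M (fun x => corr m f (utrunc k.+1 x * utrunc k.+1 x)%g).
  elim: k => [|k IH] kn.
    rewrite expr1 -[leLHS](mean_cst M) le_eqVlt; apply/orP; left; apply/eqP.
    by congr (M _); apply/funext => x; rewrite utrunc1 mulg1 corr1.
  apply: le_trans (@corr_utrunc_step (Ordinal kn) _) => //=.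
  by rewrite expnSr exprM lerXn2r ?nnegrE ?exprn_ge0 ?IH ?(le_trans _ (IH _))
    ?exprn_ge0// ltnW.
have := H n.-1; rewrite prednK// => /(_ (leqnn _)).
by congr (_ <= M _); apply/funext => x; rewrite utrunc_all.
Qed.

End UnitriangularSquares.

(** * Ultrafilter limits and a finitely additive Fatou lemma *)

Section UltraLimit.
Context (K : realType) (I : Type) (U : set_system I) (UU : UltraFilter U).
Implicit Types (u : I -> K).

Definition ulim u : K := lim (u @ U).

(** A bounded function pushes the ultrafilter into a compact interval, where it has a cluster point;
    for an ultrafilter this is a limit. *)
Lemma cvg_ulim u : bddf u -> u @ U --> ulim u.
Proof.
move=> [C uC].
have h : U (u @^-1` [set` `[- C, C]]).
  by apply: filterE => i; rewrite /= in_itv /= -ler_norml.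
have [p [_ cp]] := @segment_compact K (- C) C (u @ U) _ h.
suff up : u @ U --> p by rewrite /ulim (cvg_lim _ up).
move=> V Vp; have [//|UV] := in_ultra_setVsetC (u @^-1` V) UU.
have [x [/= nVx Vx]] := cp (~` V) V UV Vp.
by case: nVx.
Qed.

Lemma ulimP u l : u @ U --> l -> ulim u = l.
Proof. by move=> ul; apply: cvg_lim. Qed.

Lemma ulim_cst c : ulim (fun=> c) = c.
Proof. by apply: ulimP; exact: cvg_cst. Qed.

Lemma ulimD u v : bddf u -> bddf v ->
  ulim (fun i => u i + v i) = ulim u + ulim v.
Proof. by move=> bu bv; apply: ulimP; apply: cvgD; exact: cvg_ulim. Qed.

Lemma ulimZ c u : bddf u -> ulim (fun i => c * u i) = c * ulim u.
Proof. by move=> bu; apply: ulimP; apply: cvgM;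
  [exact: cvg_cst|exact: cvg_ulim]. Qed.

Lemma ulim_ge u c : bddf u -> U [set i | c <= u i] -> c <= ulim u.
Proof. by move=> bu cu; apply: (cvgr_to_ge (cvg_ulim bu)). Qed.

Lemma ulim_le_near u v : bddf u -> bddf v -> U [set i | u i <= v i] ->
  ulim u <= ulim v.
Proof.
move=> bu bv uv; have bNu : bddf (fun i => -1 * u i).
  by apply: bddfM => //; exact: bddf_cst.
rewrite -subr_ge0 -mulN1r -ulimZ// -ulimD//; apply: ulim_ge.
  exact: bddfD.
by apply: filterS uv => i; rewrite /= mulN1r subr_ge0.
Qed.

Lemma ulim_le u v : bddf u -> bddf v -> (forall i, u i <= v i) ->
  ulim u <= ulim v.
Proof. by move=> bu bv uv; apply: ulim_le_near => //; apply: filterE. Qed.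

End UltraLimit.

Section Fatou.
Context (K : realType) (T : Type) (m : mean K T) (U : set_system nat).
Context (UU : UltraFilter U) (U_infty : forall N, U [set n | (N <= n)%N]).
Context (f : nat -> T -> K) (f0 : forall n t, 0 <= f n t) (f1 :
  forall n t, f n t <= 1).

Definition mass (C : pred T) : K := m (fun t => (C t)%:R).

Definition lmass (C : pred T) : K :=
  ulim U (fun n => m (fun t => f n t * (C t)%:R)).

Let bC (C : pred T) : bddf (fun t => (C t)%:R : K).
Proof. by exists 1 => t; rewrite normr_nat lern1 leq_b1. Qed.

Let bf n : bddf (f n). Proof. by exists 1 => t; rewrite ger0_norm. Qed.

Let bfC n C : bddf (fun t => f n t * (C t : bool)%:R).
Proof. by apply: bddfM. Qed.

Let bm C : bddf (fun n => m (fun t => f n t * (C t : bool)%:R)).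
Proof.
exists 1 => n; apply: mean_norm => t.
by rewrite normrM mulr_ile1// ?normr_nat ?lern1 ?leq_b1 ?ger0_norm.
Qed.

Let mass_ge0 C : 0 <= mass C.
Proof. by apply: mean_pos => // t; rewrite ler0n. Qed.

Let lmass_le C : lmass C <= mass C.
Proof.
rewrite -(ulim_cst UU (mass C)); apply: ulim_le => //; first exact: bddf_cst.
by move=> n; apply: mean_le => // t; rewrite ler_piMl.
Qed.

Let massU (C D : pred T) : (forall t, ~~ (C t && D t)) ->
  mass (fun t => C t || D t) = mass C + mass D.
Proof.
move=> CD; rewrite /mass -mean_add//; congr (m _); apply/funext => t.
by have := CD t; case: (C t); case: (D t); rewrite ?addr0 ?add0r.
Qed.

Let lmassU (C D : pred T) : (forall t, ~~ (C t && D t)) ->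
  lmass (fun t => C t || D t) = lmass C + lmass D.
Proof.
move=> CD; rewrite /lmass -ulimD//; congr (ulim _ _); apply/funext => n.
rewrite -mean_add//; congr (m _); apply/funext => t.
by have := CD t; case: (C t); case: (D t); rewrite ?mulr0 ?addr0 ?add0r.
Qed.

Context (L : K) (L0 : 0 < L).

(** The limiting average of the [f n] over [C] is at least [L]; positivity of the mass makes [C]
    nonempty. *)
Definition heavy C := 0 < mass C /\ L * mass C <= lmass C.

(* If no subset of some [{f N > L - e}] were heavy, disjointifying these sets
   would cover all but a part of [C] on which eventually [f N <= L - e]. *)
Lemma heavy_refine C e N0 : 0 < e -> e <= L -> heavy C ->
  exists D N, [/\ heavy D, forall t, D t -> C t, (N0 <= N)%N &
    forall t, D t -> L - e <= f N t].
Proof.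
move=> e0 eL [C0 CL]; apply: contrapT => nex.
(* [V n] is the union of the first [n] sets [D N], from [N0] on, and [D' n] is what the next one
   adds. *)
pose D N t := C t && (L - e <= f N t).
pose V n t := has (D ^~ t) (iota N0 n).
pose D' n t := D (N0 + n)%N t && ~~ V n t.
have VS n : V n.+1 = fun t => V n t || D' n t.
  apply/funext => t; rewrite /V -addn1 iotaD has_cat /= orbF /D' -/(V n t).
  by case: (V n t) => //=; rewrite andbT.
have Vdisj n t : ~~ (V n t && D' n t) by rewrite /D'; case: (V n t);
  rewrite ?andbF.
(* The deficit in heaviness; it is additive on disjoint sets and, as no [D' n] is heavy, nonnegative
   on every piece. *)
pose gap A := L * mass A - lmass A.
have gap0 n : 0 <= gap (D' n) /\ (0 < mass (D' n) -> 0 < gap (D' n)).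
  have h : 0 < mass (D' n) -> 0 < gap (D' n).
    move=> m0; rewrite subr_gt0 ltNge; apply/negP => le; apply: nex.
    exists (D' n), (N0 + n)%N; split => //; last 2 first.
    - exact: leq_addr.
    - by move=> t /andP[/andP[]].
    - by move=> t /andP[/andP[]].
  split=> //; have := mass_ge0 (D' n);
    rewrite le_eqVlt => /orP[/eqP z|/h/ltW//].
  by rewrite /gap -z mulr0 sub0r oppr_ge0 (le_trans (lmass_le _))// -z.
have gapS n : gap (V n.+1) = gap (V n) + gap (D' n).
  by rewrite /gap VS massU// lmassU//; ring.
have massS n : mass (V n.+1) = mass (V n) + mass (D' n) by rewrite VS massU.
have V0 : mass (V 0%N) = 0.
  by rewrite /mass -[RHS](mean_cst m); congr (m _); apply/funext.
have gapV0 : gap (V 0%N) = 0.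
  have := lmass_le (V 0%N); rewrite V0 => l0; apply/eqP;
    rewrite eq_le /gap V0 mulr0 sub0r oppr_ge0 l0 andbT oppr_le0.
  rewrite -(ulim_cst UU 0); apply: ulim_le => //; first exact: bddf_cst.
  by move=> n; apply: mean_pos => // t; rewrite mulr_ge0.
have gap_nd : {homo (fun n => gap (V n)) : n p / (n <= p)%N >-> n <= p}.
  by apply: homo_leq; [exact: lexx|exact: le_trans|move=> n; rewrite gapS lerDl;
    case: (gap0 n)].
have mass_nd : {homo (fun n => mass (V n)) : n p / (n <= p)%N >-> n <= p}.
  by apply: homo_leq; [exact: lexx|exact: le_trans|move=> n;
    rewrite massS lerDl].
have VC n t : V n t -> C t by move=> /hasP[N _ /andP[]].
have massVC n : mass (V n) <= mass C.
  by apply: mean_le => // t; rewrite ler_nat; have := @VC n t;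
    case: (V n t) => // ->.
have main eta : 0 < eta -> exists K0, forall n, (K0 <= n)%N ->
    gap (V n) + e * (mass C - mass (V n)) <= eta.
  (* As [m] is only finitely additive, the union of all [V n] may carry extra mass; [n] is taken
     with [mass (V n)] close to the supremum [tau] instead. *)
  move=> eta0; pose tau := sup [set mass (V n) | n in setT].
  have hs : has_sup [set mass (V n) | n in setT].
    by split; [exists (mass (V 0%N)); exists 0%N|exists (mass C) => _ [n _ <-]].
  have [_ [K0 _ <-] hK0] := sup_adherent eta0 hs.
  exists K0 => n K0n.
  have hn : tau - eta < mass (V n) := lt_le_trans hK0 (mass_nd _ _ K0n).
  (* Past [N0 + n], on [C] outside [V n] the function [f N] is at most 1 on a part of mass at most
     [eta], and below [L - e] on the rest. *)
  have key : lmass C <= lmass (V n) + (eta + (L - e) * (mass C - mass (V n))).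
    rewrite -(ulim_cst UU (eta + _)) -ulimD//; last exact: bddf_cst.
    apply: ulim_le_near => //; first by apply: bddfD => //; exact: bddf_cst.
    apply: filterS (U_infty (N0 + n)) => N /= nN.
    have [p Np] : exists p, N = (N0 + p)%N by exists (N - N0)%N;
      rewrite subnKC// (leq_trans _ nN)// leq_addr.
    have np : (n <= p)%N by move: nN; rewrite Np leq_add2l.
    have b1 : bddf (fun t => (V p.+1 t)%:R - (V n t)%:R : K) by apply:
      bddfD => //; exact: bddfN.
    have b2 : bddf (fun t => (C t)%:R - (V p.+1 t)%:R : K) by apply:
      bddfD => //; exact: bddfN.
    have b3 : bddf (fun t => (L - e) * ((C t)%:R - (V p.+1 t)%:R)) by apply:
      bddfM => //; exact: bddf_cst.
    have b4 : bddf (fun t => (V p.+1 t)%:R - (V n t)%:R + (L - e) * ((C t)%:R -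
      (V p.+1 t)%:R)) by exact: bddfD.
    have : m (fun t => f N t * (C t)%:R) <= m (fun t => f N t * (V n t)%:R +
        ((V p.+1 t)%:R - (V n t)%:R + (L - e) * ((C t)%:R - (V p.+1 t)%:R))).
      apply: mean_le => // [|t]; first exact: bddfD.
      have Vnp : V n t -> V p.+1 t.
        move=> /hasP[q qn Dq]; apply/hasP; exists q => //.
        move: qn; rewrite !mem_iota => /andP[-> /= q2].
        by rewrite (leq_trans q2)// leq_add2l leqW.
      have [Vp|nVp] := boolP (V p.+1 t).
        rewrite (VC _ _ Vp) subrr mulr0 addr0 mulr1.
        case: (V n t); rewrite ?mulr1 ?subrr ?addr0// mulr0 add0r subr0.
        exact: f1.
      have -> : V n t = false by apply: contraNF nVp.
      rewrite mulr0 subr0 !add0r subr0.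
      case Ct : (C t); rewrite ?mulr0// !mulr1.
      rewrite leNgt; apply/negP => fN; case/negP: nVp; apply/hasP; exists N.
        by rewrite mem_iota Np leq_addr/= ltn_add2l ltnS.
      by rewrite /D Ct ltW.
    rewrite mean_add// mean_add// mean_scale// !meanB//.
    move/le_trans; apply; rewrite lerD2l.
    have tp : mass (V p.+1) <= tau by apply: ub_le_sup; [case: hs|exists p.+1].
    have nd := mass_nd _ _ (leqW np).
    rewrite -/(mass _) -/(mass _) -/(mass C); apply: lerD; first by lra.
    by rewrite ler_wpM2l ?subr_ge0// lerD2l lerN2.
  by move: CL key; rewrite /gap; lra.
(* Either some piece has positive mass and its gap persists in every later [gap (V n)], or all [V n]
   are null and [e * mass C] is left over; [main] excludes both. *)
have [[n mn]|nomass] := pselect (exists n, 0 < mass (D' n)).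
  have gn := (gap0 n).2 mn.
  have [K0 hK0] := main (gap (D' n) / 2) (divr_gt0 gn (@ltr0n K 2)).
  have := hK0 _ (leq_maxl K0 n.+1).
  have := gap_nd _ _ (leq_maxr K0 n.+1).
  have := gap_nd _ _ (leq0n n).
  have := massVC (maxn K0 n.+1).
  rewrite gapV0 gapS -subr_ge0 => h1 h2 h3 h4.
  have := mulr_ge0 (ltW e0) h1.
  by lra.
have mV n : mass (V n) = 0.
  elim: n => // n IH; rewrite massS IH add0r; apply/eqP;
    rewrite eq_le mass_ge0 andbT leNgt.
  by apply/negP => h; apply: nomass; exists n.
have eC : 0 < e * mass C by rewrite mulr_gt0.
have [K0 hK0] := main (e * mass C / 2) (divr_gt0 eC (@ltr0n K 2)).
have := hK0 _ (leqnn _); rewrite mV subr0.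
have := gap_nd _ _ (leq0n K0); rewrite gapV0.
by lra.
Qed.

(** Iterating [heavy_refine] gives nested sets [Cs k] of positive mass, hence inhabited; a point of
    [Cs j.+1] satisfies all bounds imposed up to step [j]. *)
Lemma fatou_points : L <= ulim U (fun n => m (f n)) ->
  exists (t : nat -> T) (N : nat -> nat), (forall k, (k <= N k)%N) /\
    forall k j, (k <= j)%N -> L - L / k.+1%:R <= f (N k) (t j).
Proof.
move=> hL; have hT : heavy predT.
  have m1 : mass predT = 1 by rewrite -(mean_cst m 1).
  split; rewrite m1// mulr1; apply: le_trans hL _; rewrite le_eqVlt; apply/orP;
    left; apply/eqP.
  by congr (ulim U _); apply/funext => n; congr (m _); apply/funext => t;
    rewrite mulr1.
have step : forall p : nat * pred T, exists q : pred T * nat, heavy p.2 ->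
    [/\ heavy q.1, forall t, q.1 t -> p.2 t, (p.1 <= q.2)%N &
      forall t, q.1 t -> L - L / p.1.+1%:R <= f q.2 t].
  move=> [k C] /=; have [hC|nC] := pselect (heavy C); last by exists (C, 0%N).
  have ek0 : 0 < L / k.+1%:R by rewrite divr_gt0// ltr0n.
  have ekL : L / k.+1%:R <= L by rewrite ler_pdivrMr ?ltr0n// ler_peMr ?ler1n//
    ltW.
  have [D [N [h1 h2 h3 h4]]] := heavy_refine k ek0 ekL hC.
  by exists (D, N).
have [F HF] := choice step.
pose Cs := fix Cs (k : nat) : pred T :=
  if k is k'.+1 then (F (k', Cs k')).1 else predT.
have hCs k : heavy (Cs k) by elim: k => // k IH; case: (HF (k, Cs k) IH).
have Csub j k t : (k <= j)%N -> Cs j t -> Cs k t.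
  elim: j => [|j IH]; first by rewrite leqn0 => /eqP ->.
  rewrite leq_eqVlt => /orP[/eqP -> //|kj] Ct; apply: IH => //.
  by case: (HF (j, Cs j) (hCs j)) => _ + _ _; apply.
have pt k : exists t, Cs k t.
  apply: contrapT => /forallNP h; have [+ _] := hCs k.
  rewrite (_ : mass _ = 0) ?ltxx// -[RHS](mean_cst m); congr (m _).
  by apply/funext => t; have /negP/negbTE -> := h t.
have [t ht] := choice (fun k => pt k.+1).
exists t, (fun k => (F (k, Cs k)).2); split=> [k|k j kj].
  by case: (HF (k, Cs k) (hCs k)).
case: (HF (k, Cs k) (hCs k)) => _ _ _; apply.
by apply: (Csub j.+1 k.+1) => //; exact: ht.
Qed.

End Fatou.

(** * Invariant means from nearly invariant finite sets *)

Section FolnerMean.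
Context (K : realType) (I : Type) (U : set_system I) (UU : UltraFilter U).

Lemma avg_bound J (s : seq J) (f : J -> K) C :
  (forall j, `|f j| <= C) -> `|avg s f| <= `|C|.
Proof.
move=> fC; have [s0|s0] := posnP (size s).
  by rewrite /avg (size0nil s0) big_nil mul0r normr0.
by apply: le_trans (avg_norm s0 fC) (ler_norm _).
Qed.

Lemma bddf_avg_seq J (s : I -> seq J) (f : J -> K) :
  bddf f -> bddf (fun i => avg (s i) f).
Proof. by move=> [C fC]; exists `|C| => i; exact: avg_bound. Qed.

Definition ultra_mean J (s : I -> seq J) (s0 : U [set i | (0 < size (s i))%N]) :
  mean K J.
Proof.
exists (fun f => ulim U (fun i => avg (s i) f)).
- move=> f g bf bg; rewrite -ulimD; try exact: bddf_avg_seq.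
  by congr (ulim U _); apply/funext => i; rewrite avgD.
- move=> c f bf; rewrite -ulimZ; last exact: bddf_avg_seq.
  by congr (ulim U _); apply/funext => i; rewrite avgZ.
- move=> f bf f0; apply: ulim_ge; first exact: bddf_avg_seq.
  by apply: filterE => i /=; rewrite divr_ge0// sumr_ge0.
- rewrite -[RHS](ulim_cst UU 1); have b1 := bddf_cst J (1 : K).
  apply/eqP; rewrite eq_le; apply/andP; split.
  + apply: ulim_le_near; [exact: bddf_avg_seq|exact: bddf_cst|].
    by apply: filterS s0 => i /= si; rewrite avg_cst.
  + apply: ulim_le_near; [exact: bddf_cst|exact: bddf_avg_seq|].
    by apply: filterS s0 => i /= si; rewrite avg_cst.
Defined.

Lemma ultra_meanE J (s : I -> seq J) s0 f :
  @ultra_mean J s s0 f = ulim U (fun i => avg (s i) f).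
Proof. by []. Qed.

End FolnerMean.

Section TranslateAverage.
Context (K : realType) (G : groupType).

Lemma sum_fset_diff (X Y : {fset G}) (f : G -> K) C : (forall g, `|f g| <= C) ->
  `|\sum_(x <- X) f x - \sum_(x <- Y) f x| <= C * #|` fsymdiff X Y|%:R.
Proof.
move=> fC.
have C0 : 0 <= C := le_trans (normr_ge0 _) (fC 1%g).
have split (Z Z' : {fset G}) : \sum_(x <- Z) f x
    = \sum_(x <- (Z `&` Z')%fset) f x + \sum_(x <- (Z `\` Z')%fset) f x.
  rewrite (big_fsetID _ (mem Z')); congr (_ + _).
    by apply: eq_fbigl => x; rewrite !inE.
  by apply: eq_fbigl => x; rewrite !inE andbC.
have bound (Z : {fset G}) : `|\sum_(x <- Z) f x| <= C * #|` Z|%:R.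
  apply: le_trans (ler_norm_sum _ _ _) _.
  apply: le_trans (ler_sum _ (fun x _ => fC x)) _.
  by rewrite big_const_seq count_predT iter_addr_0 mulr_natr.
rewrite (split X Y) (split Y X) [(Y `&` X)%fset]fsetIC opprD addrACA subrr
  add0r.
apply: le_trans (ler_normB _ _) _.
apply: le_trans (lerD (bound _) (bound _)) _.
rewrite -mulrDr -natrD ler_wpM2l// ler_nat /fsymdiff cardfsU.
rewrite (_ : ((X `\` Y) `&` (Y `\` X))%fset = fset0) ?cardfs0 ?subn0//.
apply/fsetP => x; rewrite !inE; by case: (x \in X); case: (x \in Y).
Qed.

Lemma sum_translate g (X : {fset G}) (f : G -> K) :
  \sum_(x <- left_translate g X) f x = \sum_(x <- X) f (g * x)%g.
Proof. by rewrite big_imfset//= => x y _ _; exact: mulgI. Qed.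

Lemma avg_translate g (X : {fset G}) (f : G -> K) C :
  (forall g, `|f g| <= C) ->
  `|avg X (fun x => f (g * x)%g) - avg X f|
    <= C * (#|` fsymdiff (left_translate g X) X|%:R / #|` X|%:R).
Proof.
move=> fC; rewrite /avg -sum_translate -mulrBl normrM mulrA.
rewrite [X in _ * X <= _]ger0_norm ?invr_ge0//.
by rewrite ler_wpM2r ?invr_ge0// sum_fset_diff.
Qed.

(** The change under translation is bounded by [C] times the boundary ratio, which tends to 0 along
    [U]. *)
Lemma ultra_mean_left_invariant I (U : set_system I) (UU : UltraFilter U)
  (E : I -> {fset G}) s0 :
  (forall g, (fun i => #|` fsymdiff (left_translate g (E i)) (E i)|%:R / #|` E
    i|%:R : K)
     @ U --> (0 : K)) ->
  left_invariant (@ultra_mean K I U UU G (fun i => enum_fset (E i)) s0).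
Proof.
move=> EF g f bf; rewrite !ultra_meanE; have [C fC] := bf.
have bfg : bddf (fun t => f (g * t)%g) by exact: (bddf_comp (fun t => g * t)%g).
have c1 := cvg_ulim UU (bddf_avg_seq (fun i => enum_fset (E i)) bfg).
have c2 := cvg_ulim UU (bddf_avg_seq (fun i => enum_fset (E i)) bf).
have c12 := cvgB c1 c2.
have c0 : (fun i => C * (#|` fsymdiff (left_translate g (E i)) (E i)|%:R / #|` E
  i|%:R))
    @ U --> C * 0 by apply: cvgM; [exact: cvg_cst|exact: EF].
rewrite mulr0 in c0.
apply/eqP; rewrite -subr_eq0 -normr_le0; apply/ler_addgt0Pr => e e0;
  rewrite add0r.
have := cvgr_to_le (cvg_norm (c12 _)); apply.
move/cvgrPdist_lt: c0 => /(_ e e0); apply: filterS => i /=.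
rewrite sub0r normrN => /(le_lt_trans (ler_norm _)) /ltW; apply: le_trans.
exact: avg_translate.
Qed.

End TranslateAverage.

Section UpperDensity.
Context (K : realType).
Implicit Types u : nat -> K.

Lemma bounded_fun01 u : (forall n, 0 <= u n <= 1) -> bounded_fun u.
Proof.
move=> u01; exists 1; split => // y y1 n _ /=.
by have /andP[a b] := u01 n; rewrite ger0_norm// (le_trans b)// ltW.
Qed.

Let sdrop_sup u n : (forall n, 0 <= u n <= 1) -> has_sup (sdrop u n).
Proof.
move=> u01; split; first by exists (u n), n => /=.
by exists 1 => _ [k _ <-]; case/andP: (u01 k).
Qed.

Lemma limn_sup_frequently u c N : (forall n, 0 <= u n <= 1) ->
  c < limn_sup u -> exists n, (N <= n)%N /\ c < u n.
Proof.
move=> u01 cu; apply: contrapT => /forallNP h.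
suff : limn_sup u <= c by rewrite leNgt cu.
rewrite limn_supE; last exact: bounded_fun01.
apply: (@le_trans _ _ (sups u N)).
  apply: ge_inf; last by exists N.
  exists 0 => _ [n _ <-]; apply: (@le_trans _ _ (u n));
    first by case/andP: (u01 n).
  by apply: ub_le_sup; [case: (sdrop_sup n u01)|exists n => /=].
apply: ge_sup; first by exists (u N), N => /=.
by move=> _ [n Nn <-]; rewrite leNgt; apply/negP => cn; apply: (h n).
Qed.

Lemma limn_sup_ge u c : (forall n, 0 <= u n <= 1) ->
  (forall e N, 0 < e -> exists n,
    (N <= n)%N /\ c - e <= u n) -> c <= limn_sup u.
Proof.
move=> u01 h; rewrite limn_supE; last exact: bounded_fun01.
apply: lb_le_inf; first by exists (sups u 0%N), 0%N.
move=> _ [N _ <-]; apply/ler_addgt0Pr => e e0; rewrite -lerBlDr.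
have [n [Nn cn]] := h e N e0; apply: le_trans cn _.
by apply: ub_le_sup; [case: (sdrop_sup N u01)|exists n].
Qed.

Context (G : groupType).

Lemma relative_densityE (F : nat -> {fset G}) (B : set G) n :
  relative_density K F B n = avg (F n) (fun x => (x \in B)%:R).
Proof.
rewrite /relative_density /avg; congr (_ / _).
rewrite card_fset_sum1 big_fset /= natr_sum big_mkcond /=.
by apply: eq_bigr => x _; case: (x \in B).
Qed.

Lemma relative_density01 (F : nat -> {fset G}) (B : set G) n :
  0 <= relative_density K F B n <= 1.
Proof.
rewrite relative_densityE divr_ge0 ?sumr_ge0//=.
have [s0|s0] := posnP (size (enum_fset (F n))).
  by rewrite /avg s0 invr0 mulr0.
rewrite -[leRHS](@avg_cst K _ (F n) 1)//; apply: le_avg => x.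
by rewrite lern1 leq_b1.
Qed.

Lemma upper_density01 (F : nat -> {fset G}) (B : set G) :
  0 <= upper_density K F B <= 1.
Proof.
have u01 := relative_density01 F B; apply/andP; split.
  apply: limn_sup_ge => // e N e0; exists N; split => //.
  apply: (@le_trans _ _ 0); first by rewrite sub0r oppr_le0 ltW.
  by case/andP: (u01 N).
rewrite leNgt; apply/negP => /(limn_sup_frequently 0 u01)[n [_]].
by apply/negP; rewrite -leNgt; case/andP: (u01 n).
Qed.

End UpperDensity.

(** * Densities and product sets *)

Section BanachDensityMean.
Context (K : realType) (G : groupType) (A : set G).
Context (F0 : nat -> {fset G}) (F0_Folner : left_Folner K F0).

Let d := left_upper_Banach_density K A.

Let density_has_sup : has_sup [set upper_density K F A | F in @left_Folner K G].
Proof.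
split; first by exists (upper_density K F0 A), F0.
by exists 1 => _ [F _ <-]; case/andP: (upper_density01 K F A).
Qed.

Lemma Banach_density_ge0 : 0 <= d.
Proof.
apply: (@le_trans _ _ (upper_density K F0 A)).
  by case/andP: (upper_density01 K F0 A).
by apply: ub_le_sup; [case: density_has_sup|exists F0].
Qed.

Let boundary (g : G) (E : {fset G}) : K :=
  #|` fsymdiff (left_translate g E) E|%:R / #|` E|%:R.

Let good (p : {fset G} * nat) : set {fset G} := [set E |
  [/\ (0 < size (enum_fset E))%N, forall g,
    g \in p.1 -> boundary g E <= p.2.+1%:R^-1 &
    d - p.2.+1%:R^-1 <= avg E (fun x => (x \in A)%:R)]].

Let good_nonempty p : good p !=set0.
Proof.
case: p => S k; have e0 : 0 < k.+1%:R^-1 :> K by rewrite invr_gt0 ltr0n.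
have [_ [F [F_ne F_inv] <-] hF] := sup_adherent e0 density_has_sup.
have [N hN] : exists N, forall n, (N <= n)%N -> forall g, g \in S ->
    boundary g (F n) <= k.+1%:R^-1.
  have : \forall n \near \oo, forall g,
    g \in enum_fset S -> boundary g (F n) <= k.+1%:R^-1.
    elim: (enum_fset S) => [|g s IH]; first exact: nearW.
    have := F_inv g => /cvgrPdist_lt /(_ _ e0) hg.
    near=> n => g'; rewrite inE => /orP[/eqP ->|g's].
      apply: le_trans (ler_norm _) _; rewrite -normrN -sub0r ltW//.
      by near: n.
    by move: g' g's; near: n.
  by move=> [N _ hN]; exists N.
have [n [Nn hn]] := limn_sup_frequently N (relative_density01 K F A) hF.
exists (F n); split => /=.
- by rewrite lt0n; apply: contra (F_ne n) => /eqP/cardfs0_eq ->.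
- exact: hN.
- by rewrite -relative_densityE ltW.
Unshelve. all: by end_near. Qed.

(** The supremum [d] need not be attained by one Folner sequence, so the ultrafilter lives on finite
    sets: it contains every [good p], hence encodes near invariance and density near [d] at all
    tolerances at once. *)
Lemma Banach_density_mean : exists m : mean K G,
  left_invariant m /\ d <= m (fun t => (t \in A)%:R).
Proof.
have invn_le k l : (k <= l)%N -> l.+1%:R^-1 <= k.+1%:R^-1 :> K.
  by move=> kl; rewrite lef_pV2 ?posrE ?ltr0n// ler_nat.
have FF : Filter (filter_from setT good).
  apply: filter_fromT_filter; first by exists (fset0, 0%N).
  move=> [S k] [S' k']; exists ((S `|` S')%fset, maxn k k').
  move=> E [/= E0 hS hd]; split; split => //=.
  - by move=> g gS; apply: le_trans (hS g _) (invn_le _ _ (leq_maxl _ _));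
    rewrite inE gS.
  - by apply: le_trans hd; rewrite lerD2l lerN2 invn_le// leq_maxl.
  - by move=> g gS; apply: le_trans (hS g _) (invn_le _ _ (leq_maxr _ _));
    rewrite inE gS orbT.
  - by apply: le_trans hd; rewrite lerD2l lerN2 invn_le// leq_maxr.
have PF : ProperFilter (filter_from setT good).
  by apply: filter_from_proper => p _; exact: good_nonempty.
have [U [UU FU]] := ultraFilterLemma PF.
have Ugood p : U (good p) by apply: FU; exists p.
have s0 : U [set E : {fset G} | (0 < size (enum_fset E))%N].
  by apply: filterS (Ugood (fset0, 0%N)) => E [].
have small (e : K) : 0 < e -> exists k, k.+1%:R^-1 < e.
  move=> e0; exists (Num.truncn e^-1); rewrite invf_plt ?posrE ?ltr0n//.
  exact: truncnS_gt.
exists (ultra_mean K UU s0); split.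
  apply: ultra_mean_left_invariant => g; apply/cvgrPdist_lt => e e0.
  have [k ke] := small e e0.
  apply: filterS (Ugood ([fset g]%fset, k)) => E [_ /(_ g (fset11 g)) h _] /=.
  by rewrite sub0r normrN ger0_norm ?divr_ge0//; apply: le_lt_trans h ke.
have b1 : bddf (fun t : G => (t \in A)%:R : K).
  by exists 1 => t; rewrite normr_nat lern1 leq_b1.
rewrite ultra_meanE; apply/ler_addgt0Pr => e e0; rewrite -lerBlDr.
apply: ulim_ge; first exact: bddf_avg_seq.
have [k ke] := small e e0.
apply: filterS (Ugood (fset0, k)) => E [_ _ h] /=; apply: le_trans h.
by rewrite lerD2l lerN2 ltW.
Qed.

End BanachDensityMean.

(** * From correlations at squares to a product set *)

Section ProductSet.
Context (K : realType) (G : groupType) (A : set G).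
Context (F : nat -> {fset G}) (F_Folner : left_Folner K F).
Context (m : mean K G) (mi : left_invariant m).

Let f (t : G) : K := (t \in A)%:R.

Let f01 t : 0 <= f t <= 1.
Proof. by rewrite ler0n lern1 leq_b1. Qed.

Let bf : bddf f.
Proof. by exists 1 => t; rewrite ger0_norm; case/andP: (f01 t). Qed.

Lemma product_set_from_corr (L : K) : 0 < L ->
  (forall M : mean K G, left_invariant M -> L <= M (fun x => corr m f (x *
    x)%g)) ->
  exists B : set G, L <= upper_density K F B /\
    product_set B B `<=` product_set A (inverse_set A).
Proof.
move=> L0 hL; have [F_ne F_inv] := F_Folner.
have [U [UU FU]] := ultraFilterLemma (T := nat) (F := \oo) _.
have Uoo N : U [set n | (N <= n)%N] by apply: FU; exists N.
have s0 : U [set n | (0 < size (enum_fset (F n)))%N].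
  apply: filterE => n /=.
  by rewrite lt0n; apply: contra (F_ne n) => /eqP/cardfs0_eq ->.
have Mi : left_invariant (ultra_mean K UU s0).
  by apply: ultra_mean_left_invariant => g V V0; apply: FU; exact: F_inv.
(* [fN n t] is the density in [F n] of the set [B_t] of the overview; its [m]-mean is the average
   over [F n] of the correlation at squares. *)
pose fN n t := avg (F n) (fun x => f (x * t)%g * f (x^-1 * t)%g).
have ff01 (t t' : G) : 0 <= f t * f t' <= 1.
  by case/andP: (f01 t) => *; case/andP: (f01 t') => *;
    rewrite mulr_ge0// mulr_ile1.
have fN0 n t : 0 <= fN n t.
  by rewrite divr_ge0// sumr_ge0// => x _;
    case/andP: (ff01 (x * t)%g (x^-1 * t)%g).
have Fn0 n : (0 < size (enum_fset (F n)))%N.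
  by rewrite lt0n; apply: contra (F_ne n) => /eqP/cardfs0_eq ->.
have fN1 n t : fN n t <= 1.
  rewrite -[leRHS](@avg_cst K _ (F n) 1)//; apply: le_avg => x.
  by case/andP: (ff01 (x * t)%g (x^-1 * t)%g).
have mfN : L <= ulim U (fun n => m (fN n)).
  apply: le_trans (hL _ Mi) _; rewrite ultra_meanE le_eqVlt; apply/orP; left;
    apply/eqP.
  congr (ulim U _); apply/funext => n; rewrite /fN mean_avg; last first.
    move=> x; apply: bddfM; first exact: (bddf_comp (fun t => x * t)%g).
    exact: (bddf_comp (fun t => x^-1 * t)%g).
  by congr (avg _ _); apply/funext => x; rewrite corrE// invgK.
have [t [N [Nk hN]]] := @fatou_points K G m U UU Uoo fN fN0 fN1 L L0 mfN.
(* The limit along [U] of the translates [A t_j^-1]. *)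
pose Ainf : set G := [set x | U [set j | A (x * t j)%g]].
exists [set x | Ainf x /\ Ainf x^-1%g]; split; last first.
  (* One index [j] serves both factors, and [b b' = (b t_j) (b'^-1 t_j)^-1]. *)
  move=> _ [b [hb _] [b' [_ hb'] <-]].
  have [j [/= h1 h2]] := filter_ex (filterI hb hb').
  exists (b * t j)%g => //; exists (b'^-1 * t j)^-1%g;
    first by exists (b'^-1 * t j)%g.
  by rewrite invgM invgK mulgA mulgK.
apply: limn_sup_ge => [n|e N0 e0]; first exact: relative_density01.
have [k [kN0 ke]] : exists k, (N0 <= k)%N /\ L / k.+1%:R <= e.
  pose k := maxn N0 (Num.truncn (L / e)); exists k; split;
    first exact: leq_maxl.
  rewrite ler_pdivrMr ?ltr0n// mulrC -ler_pdivrMr// ltW//.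
  by apply: lt_le_trans (truncnS_gt _) _; rewrite ler_nat ltnS leq_maxr.
exists (N k); split; first exact: leq_trans kN0 (Nk k).
(* For each [x] the implication holds for [U]-almost all [j], so a single [j] serves the finitely
   many [x] of [F (N k)]; within [F (N k)] the set [B_t] at [t = t_j] then lies in the limit set. *)
have Uinf x : U [set j | A (x * t j)%g -> Ainf x].
  have [h|h] := in_ultra_setVsetC [set j | A (x * t j)%g] UU.
    by apply: filterE => j /= _; exact: h.
  by apply: filterS h => j /= nA /nA.
have [j [kj hj]] : exists j, (k <= j)%N /\ forall x,
  x \in enum_fset (F (N k)) ->
    (A (x * t j)%g -> Ainf x) /\ (A (x^-1 * t j)%g -> Ainf x^-1%g).
  suff : U [set j | (k <= j)%N /\ forall x, x \in enum_fset (F (N k)) ->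
    (A (x * t j)%g -> Ainf x) /\ (A (x^-1 * t j)%g -> Ainf x^-1%g)] by exact:
      filter_ex.
  apply: filterI; first exact: Uoo.
  elim: (enum_fset _) => [|x s IH]; first exact: filterE.
  apply: filterS (filterI (filterI (Uinf x) (Uinf x^-1%g)) IH).
  by move=> j [[h1 h2] h3] y; rewrite inE => /orP[/eqP ->//|/h3].
apply: (@le_trans _ _ (fN (N k) (t j))).
  by apply: le_trans (hN k j kj); rewrite lerD2l lerN2.
rewrite relative_densityE /fN /avg ler_wpM2r ?invr_ge0// big_seq [leRHS]big_seq.
apply: ler_sum => x xF; rewrite /f -natrM mulnb ler_nat.
have [hx hx'] := hj x xF.
have [/andP[/set_mem h1 /set_mem h2]|//] := boolP (_ && _).
have -> // : x \in [set x | Ainf x /\ Ainf x^-1%g].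
by apply/mem_set; split; [exact: hx|exact: hx'].
Qed.

End ProductSet.

Theorem theorem1p33 (K : realType) (S : pzRingType) (R : nonUnitalSubring S)
    (R_comm : {in R &, commutative (fun x y : S => x * y)})
    (R_countable : [set x : S | x \in R] #= [set: nat])
    (n : nat) (n_gt0 : (0 < n)%N)
    (A : set (UT R n)) (F : nat -> {fset UT R n})
    (F_Folner : left_Folner K F) :
  exists B : set (UT R n),
    upper_density K F B >= left_upper_Banach_density K A ^+ (2 ^ n.-1) /\
    product_set B B `<=` product_set A (inverse_set A).
Proof.
have [m [mi mA]] := Banach_density_mean A F_Folner.
set d := left_upper_Banach_density K A in mA *.
(* A nonpositive bound is met by the empty set; otherwise the bound is positive, as the Fatou
   argument requires. *)
have [d0|d0] := leP (d ^+ (2 ^ n.-1)) 0.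
  exists set0; split; last by move=> _ [x []].
  by apply: (le_trans d0); case/andP: (upper_density01 K F set0).
have d_ge0 : 0 <= d := Banach_density_ge0 A F_Folner.
apply: (product_set_from_corr F_Folner mi d0) => M Mi.
have f1 (t : UT R n) : (t \in A)%:R <= 1 :> K by rewrite lern1 leq_b1.
apply: le_trans (corr_square_lower mi (fun t => ler0n K (t \in A)) f1 Mi n_gt0).
rewrite (_ : (fun t => _ ^+ 2) = fun t => (t \in A)%:R); last first.
  by apply/funext => t; case: (t \in A); rewrite ?expr1n ?expr0n.
by rewrite lerXn2r// nnegrE (le_trans d_ge0).
Qed.
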